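(* Let $G$ be a connected finite simple graph with vertex set $[n]$. Let $d$ be a positive integer such that the vertices $1,\ldots,d$ are pairwise adjacent, and assume the labeling is such that for every $k>1$ the vertex $k$ is adjacent to some vertex of label less than $k$. Let $q$ be an indeterminate and $\widehat\chi_d(q)=\chi_G(q)/(q(q-1)\cdots(q-d+1))$ (a polynomial). Then for every $i\ge0$, the number $(-1)^{n-d-i}[q^i]\widehat\chi_d(q+1)$ equals the number of acyclic orientations of $G$ having exactly $d+i$ source-components, such that the vertices $1,2,\ldots,d$ lie in pairwise different source-components and the vertex $1$ is the unique sink.
   Context: $\chi_G$ is the chromatic polynomial of $G$. A sink is a vertex with no outgoing edge. Source-components of an acyclic orientation $\gamma$ of $G$: for $w\in[n]$ let $R_w$ be the set of vertices reachable from $w$ by a directed path (with $w\in R_w$); define recursively $S_1,S_2,\ldots$: if $\bigcup_{l<k}S_l=[n]$ then $S_k=\emptyset$, otherwise $S_k=R_m\setminus\bigcup_{l<k}S_l$ with $m=\min([n]\setminus\bigcup_{l<k}S_l)$. The non-empty $S_k$ are the source-components. *)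

(* Defs.v *)
From HB Require Import structures.
From mathcomp Require Import all_boot all_order all_algebra.

Set Implicit Arguments.
Unset Strict Implicit.
Unset Printing Implicit Defensive.

Import Order.TTheory GRing.Theory Num.Theory.

Local Open Scope ring_scope.

(* The vertex set [n] = {1, ..., n} is encoded as 'I_n = {0, ..., n-1}: the    *)
(* vertex labelled k is the ordinal of value k.-1.                            *)
Record sgraph (n : nat) := SGraph {
  adj :> rel 'I_n;
  adj_sym : symmetric adj;
  adj_irr : irreflexive adj
}.

Definition connected_graph n (G : sgraph n) : Prop :=
  forall x y : 'I_n, connect G x y.

Definition proper_coloring n (G : sgraph n) k (f : {ffun 'I_n -> 'I_k}) :=
  [forall x, forall y, G x y ==> (f x != f y)].

Definition num_colorings n (G : sgraph n) (k : nat) : nat :=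
  #|[set f : {ffun 'I_n -> 'I_k} | proper_coloring G f]|.

(* q (q - 1) ... (q - d + 1) *)
Definition falling_poly (d : nat) : {poly int} :=
  \prod_(j < d) ('X - (j%:R)%:P).

Lemma falling_poly_monic d : falling_poly d \is monic.
Proof. by apply: rpred_prod => j _; rewrite monicXsubC. Qed.

Lemma horner_falling_poly d (k : nat) : (falling_poly d).[k%:R] = (k ^_ d)%:R.
Proof.
rewrite /falling_poly; elim: d => [|d IHd]; first by rewrite big_ord0 hornerC.
rewrite big_ord_recr /= hornerM IHd hornerXsubC ffactnSr natrM.
have [le_dk | lt_kd] := leqP d k; first by rewrite natrB.
by rewrite ffact_small // !mul0r.
Qed.

Lemma falling_polyD d m :
  falling_poly (d + m) =
  falling_poly d * \prod_(j < m) ('X - ((d + j)%:R)%:P).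
Proof. by rewrite /falling_poly big_split_ord. Qed.

Lemma poly_eq_nat (p q : {poly int}) :
  (forall k : nat, p.[k%:R] = q.[k%:R]) -> p = q.
Proof.
move=> epq; apply/eqP; rewrite -subr_eq0; apply/eqP.
pose rs := [seq (k%:R : int) | k <- iota 0 (size (p - q))].
apply: (@roots_geq_poly_eq0 _ _ rs); last by rewrite size_map size_iota.
  by apply/allP => _ /mapP[k _ ->]; rewrite rootE hornerD hornerN epq subrr.
rewrite map_inj_uniq ?iota_uniq // => a b /eqP.
by rewrite eqr_nat => /eqP.
Qed.

Definition stable_partition n (G : sgraph n) (P : {set {set 'I_n}}) : bool :=
  partition P [set: 'I_n] &&
  [forall B in P, forall x in B, forall y in B, ~~ G x y].

Lemma num_coloringsE n (G : sgraph n) k :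
  num_colorings G k = (\sum_(P | stable_partition G P) k ^_ #|P|)%N.
Proof.
rewrite /num_colorings -sum1_card.
pose ker (f : {ffun 'I_n -> 'I_k}) := preim_partition f [set: 'I_n].
have kerP f x y : (y \in pblock (ker f) x) = (f x == f y).
  rewrite pblock_equivalence_partition ?inE //.
  by split=> // /eqP->.
rewrite (partition_big ker (stable_partition G)) /=; last first.
  move=> f; rewrite inE => /forallP pf; rewrite /stable_partition.
  have Pf := preim_partitionP f [set: 'I_n].
  rewrite {1}/ker Pf /=; apply/forall_inP => B BP.
  apply/forall_inP => x Bx; apply/forall_inP => y By.
  have [_ tI _] := and3P Pf.
  have := kerP f x y; rewrite (def_pblock tI BP Bx) By => /esym/eqP fxy.
  by apply/negP => Gxy; have /forallP/(_ y) := pf x; rewrite Gxy fxy eqxx.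
apply: eq_bigr => P /andP[Ppart /forall_inP Pst].
have [/eqP covP tI P0] := and3P Ppart.
have inP x : pblock P x \in P by rewrite pblock_mem // covP inE.
have inB x : x \in pblock P x by rewrite mem_pblock covP inE.
pose D := {B : {set 'I_n} | B \in P}.
pose blk x : D := Sub (pblock P x) (inP x).
pose F (h : {ffun D -> 'I_k}) : {ffun 'I_n -> 'I_k} := [ffun x => h (blk x)].
have blkS (B : D) x : x \in val B -> blk x = B.
  by move=> xB; apply: val_inj; rewrite /= (def_pblock tI (valP B) xB).
have Bne (B : D) : exists x, x \in val B.
  by apply/set0Pn; apply: contraNneq P0 => <-; apply: valP.
have injF : injective F.
  move=> h1 h2 /ffunP eh; apply/ffunP => B; have [x xB] := Bne B.
  by have := eh x; rewrite !ffunE (blkS _ _ xB).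
rewrite sum1_card -[k in RHS]card_ord.
have -> : #|P| = #|{: D}| by rewrite card_sig; apply: eq_card.
rewrite -card_inj_ffuns -(card_imset _ injF); apply: eq_card => f.
rewrite -topredE /= inE; apply/andP/imsetP => [[_ /eqP kf] | [h]].
  have fP x y : (y \in pblock P x) = (f x == f y) by rewrite -kf kerP.
  have fbl (B : D) : {c | forall x, x \in val B -> f x = c}.
    have [x0 x0B|noB] := pickP (mem (val B)).
      exists (f x0) => x xB; apply/eqP; rewrite -fP.
      by rewrite (def_pblock tI (valP B) xB).
    by exfalso; have [x xB] := Bne B; have := noB x; rewrite /= xB.
  exists [ffun B => sval (fbl B)]; last first.
    by apply/ffunP => x; rewrite !ffunE; case: (fbl _) => c /= ->.
  rewrite inE; apply/injectiveP => B1 B2; rewrite !ffunE.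
  case: (fbl B1) (fbl B2) => [c1 H1] [c2 H2] /= ec.
  have [x xB] := Bne B1; have [y yB] := Bne B2.
  rewrite -(blkS _ _ xB); apply: blkS.
  rewrite -(def_pblock tI (valP B2) yB) fP.
  by rewrite (H1 _ xB) (H2 _ yB) ec.
rewrite inE => /injectiveP inj_h ->.
have eF x y : (F h x == F h y) = (y \in pblock P x).
  rewrite !ffunE (inj_eq inj_h) -val_eqE /=.
  apply/eqP/idP => [->|]; first exact: inB.
  by move=> yB; rewrite (def_pblock tI (inP x) yB).
split.
  apply/forallP => x; apply/forallP => y; apply/implyP => Gxy.
  rewrite eF; apply/negP => yB.
  have /forall_inP/(_ _ (inB x))/forall_inP/(_ _ yB) := Pst _ (inP x).
  by rewrite Gxy.
rewrite eqEsubset; apply/andP; split; apply/subsetP => B.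
  move=> BP; have [_ tK K0] := and3P (preim_partitionP (F h) [set: 'I_n]).
  have /set0Pn[x xB] : B != set0 by apply: contraNneq K0 => <-.
  suff -> : B = pblock P x by [].
  by apply/setP => y; rewrite -(def_pblock tK BP xB) kerP eF.
move=> BP; have [cK tK K0] := and3P (preim_partitionP (F h) [set: 'I_n]).
have /set0Pn[x xB] : B != set0 by apply: contraNneq P0 => <-.
suff -> : B = pblock (ker (F h)) x by rewrite pblock_mem ?(eqP cK) ?inE.
by apply/setP => y; rewrite kerP eF (def_pblock tI BP xB).
Qed.

Lemma chromatic_poly_subproof n (G : sgraph n) :
  {p : {poly int} | forall k : nat, p.[k%:R] = (num_colorings G k)%:R}.
Proof.
exists (\sum_(P | stable_partition G P) falling_poly #|P|) => k.
rewrite num_coloringsE natr_sum horner_sum.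
by apply: eq_bigr => P _; rewrite horner_falling_poly.
Qed.

(* The polynomial whose value at every k : nat is the number of proper        *)
(* k-colorings of G; it is unique by chromatic_poly_unique.                   *)
Definition chromatic_poly n (G : sgraph n) : {poly int} :=
  sval (chromatic_poly_subproof G).

Lemma chromatic_polyP n (G : sgraph n) (k : nat) :
  (chromatic_poly G).[k%:R] = (num_colorings G k)%:R.
Proof. exact: (svalP (chromatic_poly_subproof G)). Qed.

Lemma chromatic_poly_unique n (G : sgraph n) (p : {poly int}) :
  (forall k : nat, p.[k%:R] = (num_colorings G k)%:R) -> p = chromatic_poly G.
Proof. by move=> Hp; apply: poly_eq_nat => k; rewrite Hp chromatic_polyP. Qed.

Definition initial_clique n (G : sgraph n) (d : nat) : Prop :=
  forall x y : 'I_n, (x < d)%N -> (y < d)%N -> x != y -> G x y.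

(* %/ is Euclidean division; it is exact under the hypotheses of              *)
(* chromatic_hatK.                                                            *)
Definition chromatic_hat n (G : sgraph n) (d : nat) : {poly int} :=
  chromatic_poly G %/ falling_poly d.

Lemma chromatic_hatK n (G : sgraph n) (d : nat) :
  (d <= n)%N -> initial_clique G d ->
  chromatic_hat G d * falling_poly d = chromatic_poly G.
Proof.
move=> le_dn cl.
suff [r Er] : exists r, chromatic_poly G = r * falling_poly d.
  by rewrite /chromatic_hat Er Pdiv.IdomainMonic.mulpK ?falling_poly_monic.
exists (\sum_(P | stable_partition G P)
          \prod_(j < #|P| - d) ('X - ((d + j)%:R)%:P)).
rewrite mulr_suml; apply/esym/chromatic_poly_unique => k.
rewrite num_coloringsE natr_sum horner_sum.
apply: eq_bigr => P /andP[Ppart /forall_inP Pst].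
have le_dP : (d <= #|P|)%N.
  have [/eqP covP tI P0] := and3P Ppart.
  have inP x : pblock P x \in P by rewrite pblock_mem // covP inE.
  have inB x : x \in pblock P x by rewrite mem_pblock covP inE.
  pose b (i : 'I_d) := pblock P (widen_ord le_dn i).
  rewrite -[d]card_ord -(card_in_imset (f := b) (D := 'I_d)).
    by apply/subset_leq_card/subsetP => _ /imsetP[i _ ->]; apply: inP.
  move=> i j _ _ eb; apply/eqP/negPn/negP => nij.
  have yB : widen_ord le_dn j \in b i by rewrite eb; apply: inB.
  have /forall_inP/(_ _ (inB _))/forall_inP/(_ _ yB)/negP :=
    Pst _ (inP (widen_ord le_dn i)).
  by apply; apply: cl => //=.
by rewrite mulrC -falling_polyD subnKC // horner_falling_poly.
Qed.

(* An orientation of G is a set of arcs (x, y), read x -> y, containing       *)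
(* exactly one of (x, y) and (y, x) for each edge and nothing else.           *)
Definition arc n (g : {set 'I_n * 'I_n}) : rel 'I_n := fun x y => (x, y) \in g.

Definition orientation n (G : sgraph n) (g : {set 'I_n * 'I_n}) : bool :=
  [forall x, forall y,
     (arc g x y || arc g y x == G x y) && ~~ (arc g x y && arc g y x)].

Definition acyclic n (g : {set 'I_n * 'I_n}) : bool :=
  [forall x, forall y, arc g x y ==> ~~ connect (arc g) y x].

Lemma acyclicP n (g : {set 'I_n * 'I_n}) :
  reflect (forall c : seq 'I_n, cycle (arc g) c -> c = [::]) (acyclic g).
Proof.
apply: (iffP idP) => [/forallP Ha [//|x p] | Hc].
  rewrite /= rcons_path => /andP[pth lst]; exfalso.
  have /forallP/(_ x) := Ha (last x p); rewrite lst /= => /negP; apply.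
  by apply/connectP; exists p.
apply/forallP => x; apply/forallP => y; apply/implyP => gxy.
apply/negP => /connectP[p pth Ex].
suff: y :: p = [::] by [].
by apply: Hc; rewrite /= rcons_path pth -Ex.
Qed.

Definition is_sink n (g : {set 'I_n * 'I_n}) (x : 'I_n) : bool :=
  [forall y, ~~ arc g x y].

Definition reachable n (g : {set 'I_n * 'I_n}) (w : 'I_n) : {set 'I_n} :=
  [set y | connect (arc g) w y].

Definition next_comp n (g : {set 'I_n * 'I_n}) (U : {set 'I_n}) : {set 'I_n} :=
  if [pick x in ~: U] is Some x0
  then reachable g [arg min_(m < x0 in ~: U) val m] :\: U
  else set0.

Fixpoint covered n (g : {set 'I_n * 'I_n}) (k : nat) : {set 'I_n} :=
  if k is k'.+1 then covered g k' :|: next_comp g (covered g k') else set0.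

(* Components are indexed from 0: source_comp g k is S_{k+1}, and covered g k *)
(* is S_1 U ... U S_k (coveredE).                                             *)
Definition source_comp n (g : {set 'I_n * 'I_n}) (k : nat) : {set 'I_n} :=
  next_comp g (covered g k).

Lemma coveredE n (g : {set 'I_n * 'I_n}) k :
  covered g k = \bigcup_(l < k) source_comp g l.
Proof.
by elim: k => [|k IHk]; rewrite ?big_ord0 // big_ord_recr /= -IHk.
Qed.

Definition source_components n (g : {set 'I_n * 'I_n}) : {set {set 'I_n}} :=
  [set source_comp g k | k : 'I_n] :\ set0.

(* Restricting the index to k < n in source_components loses nothing.         *)
Lemma source_componentsP n (g : {set 'I_n * 'I_n}) (S : {set 'I_n}) :
  reflect (S != set0 /\ exists k : nat, S = source_comp g k)
          (S \in source_components g).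
Proof.
apply: (iffP setD1P) => [[S0 /imsetP[k _ Ek]] | [S0 [k Ek]]].
  by split; [exact: S0 | exists (val k)].
split=> //; suff lt_kn : (k < n)%N.
  by apply/imsetP; exists (Ordinal lt_kn).
have step j : next_comp g (covered g j) != set0 ->
    (#|covered g j| < #|covered g j.+1|)%N.
  move=> nz; apply: proper_card; rewrite /= properUl //.
  apply: contraNN nz => /subsetP sub; apply/eqP/setP => x; rewrite inE.
  apply/negP => xN; have := sub x xN; move: xN; rewrite /next_comp.
  by case: pickP => [x0 _ |]; rewrite inE // => /andP[/negP].
have full j : next_comp g (covered g j) = set0 -> covered g j = setT.
  rewrite /next_comp; case: pickP => [x0 x0U | noU _]; last first.
    by apply/setP => x; have := noU x; rewrite !inE => /negbFE.
  case: arg_minnP => // m mU _ /setP/(_ m).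
  by rewrite !inE connect0 andbT; move: mU; rewrite inE => ->.
have nz j : (j <= k)%N -> next_comp g (covered g j) != set0.
  move=> le_jk; apply: contraNneq S0 => /full fj; rewrite Ek.
  suff fk : covered g k = setT.
    rewrite /source_comp /next_comp fk.
    by case: pickP => // x; rewrite !inE.
  elim: k le_jk {Ek} => [|k IHk]; first by rewrite leqn0 => /eqP <-.
  rewrite leq_eqVlt => /orP[/eqP <- //|/IHk] /= ->.
  by rewrite setTU.
have lek j : (j <= k.+1)%N -> (j <= #|covered g j|)%N.
  elim: j => // j IHj ltj; apply: leq_ltn_trans (IHj (ltnW ltj)) _.
  exact/step/nz.
by rewrite -[n in (k < n)%N]card_ord (leq_trans (lek _ (leqnn _))) ?max_card.
Qed.

Definition in_distinct_components n (g : {set 'I_n * 'I_n}) (d : nat) : bool :=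
  [forall S in source_components g, forall x in S, forall y in S,
     (x < d)%N && (y < d)%N ==> (x == y)].

Definition first_unique_sink n (g : {set 'I_n * 'I_n}) : bool :=
  [forall x : 'I_n, is_sink g x == (val x == 0%N)].

Definition counted_orientations n (G : sgraph n) (d i : nat) :
    {set {set 'I_n * 'I_n}} :=
  [set g | [&& orientation G g, acyclic g,
               #|source_components g| == (d + i)%N,
               in_distinct_components g d & first_unique_sink g]].

(* Main.v *)
(* Integer-valued functions on sets of vertices form a commutative ring under
   (f g)(S) = sum over A \subset S of f(A) g(S \ A).  In it let e be the signed
   indicator of the stable sets, e_c that of the sets A with A + c stable, and a(S)
   the number of acyclic orientations of G[S].  Inclusion-exclusion over sinks gives
   e a = 1, and more generally shows that G[D + S] has (prod_{c in D} e_c a^(|D|+1))(S)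
   acyclic orientations inducing a prescribed order on a clique D.

   Source-components correspond to leaders, the vertices that no smaller vertex
   reaches.  Splitting off what is reachable from D, then from the least remaining
   vertex, shows that the orientations of G[D + S] decreasing on D, weighted by
   k^(number of leaders in S), add up to (prod e_c a^(|D|+k))(S).  For D = {1, ..., d},
   being decreasing on D means that 1, ..., d lie in different source-components.  By
   the hypothesis on the labels a sink outside D is never a leader, so a further
   inclusion-exclusion over sinks multiplies the sum by e and leaves the orientations
   with unique sink 1.

   Finally e^k(V) counts proper k-colorings up to sign; since e is unipotent,
   a^k(V) = (-1)^n chi(-k), and removing the vertices of D one at a time gives
   a^k(D + S) = k (k + 1) ... (k + d - 1) (prod e_c a^(k+d))(S). *)
Require Import Defs.
From HB Require Import structures.
From mathcomp Require Import all_boot all_order all_algebra.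
From mathcomp Require Import ring.

Set Implicit Arguments.
Unset Strict Implicit.
Unset Printing Implicit Defensive.

Import Order.TTheory GRing.Theory Num.Theory.

Local Open Scope ring_scope.

(* The import of path.v shadows [Defs.arc]. *)
Local Notation arc := Defs.arc.

(** * The subset convolution ring *)

(** A separate name for this type keeps the convolution product apart from the pointwise product of
    finite functions. *)
Definition setfun (T : finType) := {ffun {set T} -> int}.
HB.instance Definition _ (T : finType) :=
  GRing.Zmodule.copy (setfun T) {ffun {set T} -> int}.

Definition setfun_one (T : finType) : setfun T := [ffun S => (S == set0)%:R].
Definition setfun_mul (T : finType) (f g : setfun T) : setfun T :=
  [ffun S : {set T} => \sum_(A : {set T} | A \subset S) f A * g (S :\: A)].

Lemma setfun_mulC (T : finType) : commutative (@setfun_mul T).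
Proof.
move=> f g; apply/ffunP => S; rewrite !ffunE.
rewrite (reindex_onto (fun A => S :\: A) (fun A => S :\: A)) /=; last first.
  by move=> A AS; rewrite setDDr setDv set0U (setIidPr AS).
apply: eq_big => A; last first.
  by case/andP=> _ /eqP eA; rewrite eA mulrC.
rewrite subsetDl /= setDDr setDv set0U.
by apply/eqP/idP => [<-|/setIidPr]; rewrite ?subsetIl.
Qed.

(** Both bracketings expand to the sum over chains $A \subseteq B \subseteq S$ of
    [f A * g (B :\: A) * h (S :\: B)]. *)
Lemma setfun_mulA (T : finType) : associative (@setfun_mul T).
Proof.
move=> f g h; apply/ffunP => S; rewrite !ffunE.
transitivity (\sum_(A : {set T} | A \subset S)
  \sum_(B : {set T} | (A \subset B) && (B \subset S)) f A * g (B :\: A) * h (S :\: B)).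
  apply: eq_bigr => A AS; rewrite ffunE mulr_sumr.
  rewrite [RHS](reindex_onto (fun B => A :|: B) (fun B => B :\: A)) /=; last first.
    by move=> B /andP[AB _]; rewrite setDE setUIr setUCr setIT; apply/setUidPr.
  apply: eq_big => B.
    rewrite subsetUl subUset AS /= subsetD setDUl setDv set0U.
    congr (_ && _); apply/idP/eqP => [dBA|<-]; first exact/setDidPl.
    by rewrite disjoints_subset setDE subsetIr.
  rewrite subsetD => /andP[BS dBA].
  by rewrite setDUl setDv set0U (setDidPl dBA) mulrA setDDl.
rewrite (exchange_big_dep (fun B : {set T} => B \subset S)) /=; last first.
  by move=> A B _ /andP[].
apply: eq_bigr => B BS; rewrite ffunE mulr_suml; apply: eq_bigl => A.
by rewrite BS andbT andb_idl // => /subset_trans; apply.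
Qed.

Lemma setfun_mul1 (T : finType) : left_id (setfun_one T) (@setfun_mul T).
Proof.
move=> f; apply/ffunP => S; rewrite !ffunE (bigD1 set0) ?sub0set //=.
rewrite ffunE eqxx mul1r setD0 big1 ?addr0 // => A /andP[_ /negPf A0].
by rewrite ffunE A0 mul0r.
Qed.

Lemma setfun_mulDl (T : finType) :
  left_distributive (@setfun_mul T) +%R.
Proof.
move=> f g h; apply/ffunP => S; rewrite !ffunE -big_split /=.
by apply: eq_bigr => A _; rewrite ffunE mulrDl.
Qed.

Lemma setfun_one_neq0 (T : finType) : setfun_one T != 0.
Proof. by apply/eqP => /ffunP/(_ set0); rewrite !ffunE eqxx. Qed.

HB.instance Definition _ (T : finType) :=
  GRing.Zmodule_isComNzRing.Build (setfun T) (@setfun_mulA T) (@setfun_mulC T)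
    (@setfun_mul1 T) (@setfun_mulDl T) (@setfun_one_neq0 T).

Lemma setfunM (T : finType) (f g : setfun T) S :
  (f * g) S = \sum_(A : {set T} | A \subset S) f A * g (S :\: A).
Proof. by rewrite [LHS]ffunE. Qed.

Lemma setfun1 (T : finType) S : (1 : setfun T) S = (S == set0)%:R.
Proof. by rewrite [LHS]ffunE. Qed.

Lemma setfunD (T : finType) (f g : setfun T) S : (f + g) S = f S + g S.
Proof. by rewrite [LHS]ffunE. Qed.

Lemma setfunN (T : finType) (f : setfun T) S : (- f) S = - f S.
Proof. by rewrite [LHS]ffunE. Qed.

Lemma setfunMn (T : finType) (f : setfun T) k S : (f *+ k) S = f S *+ k.
Proof. by elim: k => [|k IH]; rewrite ?[LHS]ffunE // !mulrS setfunD IH. Qed.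

(** Lets an identity known only at certain sets, such as those disjoint from a clique, be
    substituted inside a product. *)
Lemma setfun_mul_local (T : finType) (f f' g g' : setfun T) (S : {set T}) :
  (forall A : {set T}, A \subset S -> f A = f' A) ->
  (forall A : {set T}, A \subset S -> g A = g' A) -> (f * g) S = (f' * g') S.
Proof.
move=> ff' gg'; rewrite !setfunM; apply: eq_bigr => A AS.
by rewrite ff' // gg' // subsetDl.
Qed.

(** Reading [f] as the polynomial $\sum f(S) x^S$ in variables of square zero, this is the partial
    derivative in $x_w$ at sets avoiding [w]. At sets containing [w] it returns the value of [f], so
    the Leibniz rule below is stated for [w \notin S]. *)
Definition setfun_deriv (T : finType) (w : T) (f : setfun T) : setfun T :=
  [ffun S => f (w |: S)].

Lemma setfun_derivM (T : finType) (w : T) (f g : setfun T) (S : {set T}) :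
  w \notin S -> (f * g) (w |: S) =
  (setfun_deriv w f * g + f * setfun_deriv w g) S.
Proof.
move=> wS; rewrite setfunD !setfunM.
rewrite (bigID (fun A : {set T} => w \in A)) /=; congr (_ + _).
  rewrite (reindex_onto (fun A => w |: A) (fun A => A :\ w)) /=; last first.
    by move=> A /andP[_ wA]; rewrite setD1K.
  apply: eq_big => A.
    rewrite setU11 andbT; have [wA|wA] := boolP (w \in A).
      transitivity false; first apply/negP.
        case/andP=> _ /eqP eA; move: wA; rewrite -eA.
        by rewrite !inE eqxx.
      by apply/esym/negP => /subsetP/(_ w wA); apply/negP.
    rewrite setU1K // eqxx andbT subUset sub1set setU11 /=.
    by rewrite -[in RHS](setU1K wS) subsetD1 wA andbT.
  case/andP=> /andP[_ _] /eqP eA; rewrite ffunE; congr (_ * g _).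
  have wA : w \notin A by rewrite -eA !inE eqxx.
  by apply/setP => x; rewrite !inE; case: eqVneq => // ->; rewrite (negPf wS) andbF.
apply: eq_big => A.
  by rewrite -subsetD1 setU1K.
case/andP=> _ wA; rewrite ffunE; congr (_ * g _).
by apply/setP => x; rewrite !inE; case: eqVneq => // ->; rewrite wA.
Qed.

(** A zero derivative means vanishing at every set that contains [w]; of a subset of [w |: S] and
    its complement there, one contains [w]. *)
Lemma setfun_deriv_mul0 (T : finType) (w : T) (f g : setfun T) :
  setfun_deriv w f = 0 -> setfun_deriv w g = 0 -> setfun_deriv w (f * g) = 0.
Proof.
move=> f0 g0.
have vanish (h : setfun T) (A : {set T}) :
    setfun_deriv w h = 0 -> w \in A -> h A = 0.
  by move=> /ffunP/(_ A) + wA; rewrite ffunE (setUidPr _) ?sub1set // => ->; rewrite ffunE.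
apply/ffunP => S; rewrite ffunE setfunM big1 ?ffunE // => A _.
have [wA|wA] := boolP (w \in A); first by rewrite (vanish f) ?mul0r.
by rewrite (vanish g) ?mulr0 // !inE wA eqxx.
Qed.

(** Only non-empty [A] contribute to [f * f ^+ m], so every further factor uses up an element of
    [S]. *)
Lemma setfun_nilpotent (T : finType) (f : setfun T) m (S : {set T}) :
  f set0 = 0 -> (#|S| < m)%N -> (f ^+ m) S = 0.
Proof.
move=> f0; elim: m S => // m IHm S lt_Sm; rewrite exprS setfunM big1 // => A AS.
have [->|/set0Pn[x xA]] := eqVneq A set0; first by rewrite f0 mul0r.
rewrite IHm ?mulr0 //; apply: (@leq_trans #|S|) => //; apply: proper_card.
rewrite properEneq subsetDl andbT; apply/eqP => /setP/(_ x).
by rewrite !inE xA (subsetP AS).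
Qed.

Lemma setfun_unipotent_nil (T : finType) (f : setfun T) :
  f set0 = 1 -> (f - 1) ^+ #|T|.+1 = 0.
Proof.
move=> f1; apply/ffunP => S; rewrite setfun_nilpotent ?ffunE ?ltnS ?max_card //.
by rewrite f1 eqxx subrr.
Qed.

(** Induction on [m], with [b] and [p] free: [b * (u - 1)] is killed by a lower power of [u - 1],
    and its values follow the difference polynomial $p(X+1) - p(X)$. For [m = 0], [b] is zero and
    [p] vanishes at all naturals. *)
Lemma setfun_reciprocity (T : finType) (u v : setfun T) (S : {set T}) :
  u * v = 1 -> forall m (b : setfun T) (p : {poly int}), b * (u - 1) ^+ m = 0 ->
  (forall k : nat, (b * u ^+ k) S = p.[k%:R]) ->
  forall k : nat, (b * v ^+ k) S = p.[- k%:R].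
Proof.
move=> uv; elim=> [|m IHm] b p.
  rewrite expr0 mulr1 => -> Hp k.
  suff -> : p = 0 by rewrite horner0 mul0r ffunE.
  by apply: poly_eq_nat => j; rewrite -Hp horner0 mul0r ffunE.
move=> b0 Hp.
have H0 : b * (u - 1) * (u - 1) ^+ m = 0 by rewrite -mulrA -exprS.
have H1 j : (b * (u - 1) * u ^+ j) S = (p \Po ('X + 1) - p).[j%:R].
  rewrite hornerD hornerN horner_comp !hornerE natr1 -!Hp.
  by rewrite -mulrA mulrBl mul1r -exprS mulrBr setfunD setfunN.
elim=> [|k IHk]; first by rewrite expr0 -(expr0 u) Hp oppr0.
(* Since [u * v = 1], the left side is the difference of [b * v ^+ k] and [b * v ^+ k.+1] at [S];
   the right side is $p(-k) - p(-k-1)$. *)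
have := IHm _ _ H0 H1 k.+1.
rewrite hornerD hornerN horner_comp !hornerE -mulrA.
rewrite mulrBl mul1r [in u * _]exprS [u * _]mulrA uv mul1r mulrBr setfunD setfunN.
by rewrite IHk -[k.+1%:R]natr1 opprD addrNK => /addrI/oppr_inj.
Qed.

(** * Acyclic orientations of induced subgraphs *)

(** All arcs lie inside [S]. That no edge carries both arcs follows from acyclicity
    ([acyclic_asym]). *)
Definition acyclic_orientation n (G : sgraph n) (S : {set 'I_n})
    (g : {set 'I_n * 'I_n}) : bool :=
  acyclic g && [forall x, forall y,
    (arc g x y || arc g y x) == [&& G x y, x \in S & y \in S]].

Lemma acyclic_arc n (g : {set 'I_n * 'I_n}) x y :
  acyclic g -> arc g x y -> connect (arc g) y x = false.
Proof. by move=> /forallP/(_ x)/forallP/(_ y)/implyP ac /ac/negPf. Qed.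

Lemma acyclic_asym n (g : {set 'I_n * 'I_n}) x y :
  acyclic g -> arc g x y -> arc g y x = false.
Proof.
by move=> ac gxy; apply: contraFF (acyclic_arc ac gxy) => /connect1.
Qed.

Lemma acyclic_orientationE n (G : sgraph n) S g x y :
  acyclic_orientation G S g ->
  (arc g x y || arc g y x) = [&& G x y, x \in S & y \in S].
Proof. by case/andP=> _ /forallP/(_ x)/forallP/(_ y)/eqP. Qed.

Lemma acyclic_orientation_acyclic n (G : sgraph n) S g :
  acyclic_orientation G S g -> acyclic g.
Proof. by case/andP. Qed.

Lemma acyclic_orientation_arc n (G : sgraph n) S g x y :
  acyclic_orientation G S g -> arc g x y -> [/\ G x y, x \in S & y \in S].
Proof.
by move=> og gxy; have := acyclic_orientationE x y og; rewrite gxy => /esym/and3P.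
Qed.

(** * Restricting orientations and gluing them along a one-way cut *)

Definition restr n (A : {set 'I_n}) (g : {set 'I_n * 'I_n}) :=
  [set p in g | (p.1 \in A) && (p.2 \in A)].

Definition stack n (G : sgraph n) (P Q : {set 'I_n}) (g h : {set 'I_n * 'I_n}) :=
  g :|: h :|: [set p | [&& G p.1 p.2, p.1 \in Q & p.2 \in P]].

Lemma arc_restr n (A : {set 'I_n}) g x y :
  arc (restr A g) x y = [&& arc g x y, x \in A & y \in A].
Proof. by rewrite /arc inE. Qed.

Lemma arc_stack n (G : sgraph n) P Q g h x y :
  arc (stack G P Q g h) x y =
  [|| arc g x y, arc h x y | [&& G x y, x \in Q & y \in P]].
Proof. by rewrite /arc !inE orbA. Qed.

Lemma connect_restrW n (A : {set 'I_n}) g x y :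
  connect (arc (restr A g)) x y -> connect (arc g) x y.
Proof.
by apply: connect_sub => u v; rewrite arc_restr => /and3P[guv _ _]; apply: connect1.
Qed.

Lemma connect_restr_fwd n (A : {set 'I_n}) g x y :
  (forall u v, arc g u v -> u \in A -> v \in A) -> x \in A ->
  connect (arc g) x y -> (y \in A) && connect (arc (restr A g)) x y.
Proof.
move=> clA + /connectP[p pth ->]; elim: p x pth => [|z p IHp] x /=.
  by move=> _ ->; rewrite connect0.
case/andP=> gxz pz xA; have zA := clA _ _ gxz xA.
have /andP[-> cz] := IHp _ pz zA; apply: connect_trans cz.
by apply: connect1; rewrite arc_restr gxz xA.
Qed.

Lemma connect_restr_bwd n (A : {set 'I_n}) g x y :
  (forall u v, arc g u v -> v \in A -> u \in A) -> y \in A ->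
  connect (arc g) x y -> (x \in A) && connect (arc (restr A g)) x y.
Proof.
move=> clA + /connectP[p pth ey]; move: ey => -> {y}.
elim: p x pth => [|z p IHp] x /=; first by move=> _ ->; rewrite connect0.
case/andP=> gxz pz lA; have /andP[zA cz] := IHp _ pz lA.
have xA := clA _ _ gxz zA; rewrite xA; apply: connect_trans cz.
by apply: connect1; rewrite arc_restr gxz xA.
Qed.

Lemma acyclic_orientation_restr n (G : sgraph n) (S A : {set 'I_n}) g :
  A \subset S -> acyclic_orientation G S g -> acyclic_orientation G A (restr A g).
Proof.
move=> AS og; apply/andP; split.
  apply/forallP => x; apply/forallP => y; apply/implyP; rewrite arc_restr.
  case/and3P=> gxy _ _; apply/negP => /connect_restrW.
  by rewrite (acyclic_arc (acyclic_orientation_acyclic og) gxy).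
apply/forallP => x; apply/forallP => y; rewrite !arc_restr.
have := acyclic_orientationE x y og.
have [xA|] := boolP (x \in A); last by rewrite !andbF.
have [yA|] := boolP (y \in A); last by rewrite !andbF.
by rewrite !(subsetP AS) // !andbT => ->.
Qed.

Definition no_arc n (P Q : {set 'I_n}) (g : {set 'I_n * 'I_n}) : bool :=
  [forall x in P, forall y in Q, ~~ arc g x y].

Lemma no_arcP n (P Q : {set 'I_n}) g :
  reflect (forall x y, x \in P -> y \in Q -> ~~ arc g x y) (no_arc P Q g).
Proof.
apply: (iffP forall_inP) => [H x y xP yQ | H x xP].
  by have /forall_inP := H x xP; apply.
by apply/forall_inP => y; apply: H.
Qed.

Lemma no_arc_fwd n (G : sgraph n) (P Q : {set 'I_n}) g x y :
  acyclic_orientation G (P :|: Q) g -> no_arc P Q g ->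
  arc g x y -> x \in P -> y \in P.
Proof.
move=> og /no_arcP na gxy xP; have [_ _] := acyclic_orientation_arc og gxy.
by rewrite inE => /orP[//|yQ]; have := na _ _ xP yQ; rewrite gxy.
Qed.

Lemma no_arc_bwd n (G : sgraph n) (P Q : {set 'I_n}) g x y :
  acyclic_orientation G (P :|: Q) g -> no_arc P Q g ->
  arc g x y -> y \in Q -> x \in Q.
Proof.
move=> og /no_arcP na gxy yQ; have [_ + _] := acyclic_orientation_arc og gxy.
by rewrite inE => /orP[xP|//]; have := na _ _ xP yQ; rewrite gxy.
Qed.

Lemma stack_restr n (G : sgraph n) (P Q : {set 'I_n}) g :
  [disjoint P & Q] ->
  acyclic_orientation G (P :|: Q) g -> no_arc P Q g ->
  stack G P Q (restr P g) (restr Q g) = g.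
Proof.
move=> dPQ og na; apply/setP => -[x y].
rewrite -[LHS]/(arc _ x y) -[RHS]/(arc g x y) arc_stack !arc_restr.
have E := acyclic_orientationE x y og.
have Hf := no_arc_fwd og na; have Hb := no_arc_bwd og na.
apply/or3P/idP => [[/and3P[]|/and3P[]|/and3P[Gxy xQ yP]] //|gxy].
  move: E; rewrite Gxy !inE xQ yP orbT /= => /orP[//|gyx].
  by have := Hf _ _ gyx yP => /(disjointFr dPQ); rewrite xQ.
have [Gxy + _] := acyclic_orientation_arc og gxy; rewrite inE => /orP[xP|xQ].
  by apply: Or31; rewrite gxy xP (Hf _ _ gxy).
have [_ _] := acyclic_orientation_arc og gxy; rewrite inE => /orP[yP|yQ].
  by apply: Or33; rewrite Gxy xQ.
by apply: Or32; rewrite gxy xQ.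
Qed.

Lemma restr_stackl n (G : sgraph n) (P Q : {set 'I_n}) g h :
  [disjoint P & Q] -> acyclic_orientation G P g -> acyclic_orientation G Q h ->
  restr P (stack G P Q g h) = g.
Proof.
move=> dPQ og oh; apply/setP => -[x y].
rewrite -[LHS]/(arc _ x y) -[RHS]/(arc g x y) arc_restr arc_stack.
apply/and3P/idP => [[/or3P[//|hxy|/and3P[_ xQ _]] xP yP]|gxy].
- by have [_ xQ _] := acyclic_orientation_arc oh hxy; rewrite (disjointFr dPQ) in xQ.
- by rewrite (disjointFr dPQ) in xQ.
- by have [_ -> ->] := acyclic_orientation_arc og gxy; rewrite gxy.
Qed.

Lemma restr_stackr n (G : sgraph n) (P Q : {set 'I_n}) g h :
  [disjoint P & Q] -> acyclic_orientation G P g -> acyclic_orientation G Q h ->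
  restr Q (stack G P Q g h) = h.
Proof.
move=> dPQ og oh; apply/setP => -[x y].
rewrite -[LHS]/(arc _ x y) -[RHS]/(arc h x y) arc_restr arc_stack.
apply/and3P/idP => [[/or3P[gxy|//|/and3P[_ _ yP]] xQ yQ]|hxy].
- by have [_ xP _] := acyclic_orientation_arc og gxy; rewrite (disjointFr dPQ) in xQ.
- by rewrite (disjointFr dPQ) in yQ.
- by have [_ -> ->] := acyclic_orientation_arc oh hxy; rewrite hxy orbT.
Qed.

Lemma no_arc_stack n (G : sgraph n) (P Q : {set 'I_n}) g h :
  [disjoint P & Q] -> acyclic_orientation G P g -> acyclic_orientation G Q h ->
  no_arc P Q (stack G P Q g h).
Proof.
move=> dPQ og oh; apply/no_arcP => x y xP yQ; rewrite arc_stack !negb_or.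
apply/and3P; split; last by rewrite (disjointFr dPQ xP) andbF.
  apply/negP => gxy; have [_ _] := acyclic_orientation_arc og gxy.
  by rewrite (disjointFl dPQ).
apply/negP => hxy; have [_] := acyclic_orientation_arc oh hxy.
by rewrite (disjointFr dPQ).
Qed.

(** No arc goes from [P] to [Q], so a cycle would lie within one of the two parts, where [g] or [h]
    is acyclic. *)
Lemma acyclic_orientation_stack n (G : sgraph n) (P Q : {set 'I_n}) g h :
  [disjoint P & Q] -> acyclic_orientation G P g -> acyclic_orientation G Q h ->
  acyclic_orientation G (P :|: Q) (stack G P Q g h).
Proof.
move=> dPQ og oh; set s := stack G P Q g h.
have sub x y : arc s x y -> (x \in P :|: Q) /\ (y \in P :|: Q).
  rewrite arc_stack !inE => /or3P[/(acyclic_orientation_arc og)|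
    /(acyclic_orientation_arc oh)|/and3P[_]] => [[_]|[_]|] -> ->; by rewrite ?orbT.
have /no_arcP na := no_arc_stack dPQ og oh.
have fwd u v : arc s u v -> u \in P -> v \in P.
  move=> suv uP; have [_] := sub _ _ suv; rewrite inE => /orP[//|vQ].
  by have := na _ _ uP vQ; rewrite suv.
have bwd u v : arc s u v -> v \in Q -> u \in Q.
  move=> suv vQ; have [+ _] := sub _ _ suv; rewrite inE => /orP[uP|//].
  by have := na _ _ uP vQ; rewrite suv.
apply/andP; split.
  apply/forallP => x; apply/forallP => y; apply/implyP => sxy; apply/negP => cyx.
  have [+ _] := sub _ _ sxy; rewrite inE => /orP[xP|xQ].
    have yP := fwd _ _ sxy xP.
    have /andP[_ ] := connect_restr_fwd fwd yP cyx.
    rewrite (restr_stackl dPQ og oh).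
    rewrite (acyclic_arc (acyclic_orientation_acyclic og)) //.
    by rewrite -(restr_stackl dPQ og oh) arc_restr sxy xP.
  have /andP[yQ ] := connect_restr_bwd bwd xQ cyx.
  rewrite (restr_stackr dPQ og oh).
  rewrite (acyclic_arc (acyclic_orientation_acyclic oh)) //.
  by rewrite -(restr_stackr dPQ og oh) arc_restr sxy xQ.
apply/forallP => x; apply/forallP => y; apply/eqP; rewrite !arc_stack.
have Eg := acyclic_orientationE x y og; have Eh := acyclic_orientationE x y oh.
transitivity [|| arc g x y || arc g y x, arc h x y || arc h y x
  | [&& G x y, x \in Q & y \in P] || [&& G y x, y \in Q & x \in P]].
  by do !case: (arc _ _ _) => //=; rewrite ?orbT.
rewrite Eg Eh [G y x]adj_sym !inE; case: (G x y) => //=.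
by do !case: (_ \in _).
Qed.

(** The edges across are forced to point from [Q] to [P], so the orientation amounts to an arbitrary
    pair of orientations of the two parts. *)
Lemma sum_stack n (G : sgraph n) (P Q : {set 'I_n}) (R : nmodType)
    (F : {set 'I_n * 'I_n} -> {set 'I_n * 'I_n} -> R) :
  [disjoint P & Q] ->
  \sum_(g | acyclic_orientation G (P :|: Q) g && no_arc P Q g)
     F (restr P g) (restr Q g) =
  \sum_(g | acyclic_orientation G P g) \sum_(h | acyclic_orientation G Q h) F g h.
Proof.
move=> dPQ; rewrite pair_big /=.
rewrite (reindex_onto (fun p => stack G P Q p.1 p.2) (fun g => (restr P g, restr Q g))) /=;
  last by move=> g /andP[og na]; rewrite stack_restr.
apply: eq_big => [[g h]|[g h]] /=; last first.
  by case/andP=> _ /eqP[-> ->].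
apply/andP/andP => [[/andP[os _] /eqP[eg eh]]|[og oh]].
  split; first by rewrite -eg; exact: acyclic_orientation_restr (subsetUl _ _) os.
  rewrite -eh; exact: acyclic_orientation_restr (subsetUr _ _) os.
rewrite restr_stackl // restr_stackr // eqxx.
by rewrite acyclic_orientation_stack // no_arc_stack.
Qed.

(** * Leaders and inclusion-exclusion over sinks *)

Definition decreasing n (D : {set 'I_n}) (g : {set 'I_n * 'I_n}) : bool :=
  [forall x in D, forall y in D, (x < y)%N ==> arc g y x].

Definition dec_orientation n (G : sgraph n) (D S : {set 'I_n}) g : bool :=
  acyclic_orientation G (D :|: S) g && decreasing D g.

Definition is_leader n (g : {set 'I_n * 'I_n}) (w : 'I_n) : bool :=
  [forall x : 'I_n, (x < w)%N ==> ~~ connect (arc g) x w].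

(** Leadership refers to paths in all of [g]; only the leaders lying in [S] are collected. Hence
    vertices of [D] carry no weight in [leader_sum]. *)
Definition leaders n (S : {set 'I_n}) (g : {set 'I_n * 'I_n}) : {set 'I_n} :=
  [set w in S | is_leader g w].

Definition leader_sum n (G : sgraph n) (D : {set 'I_n}) (k : nat) :
    setfun 'I_n :=
  [ffun S => \sum_(g | dec_orientation G D S g) k%:R ^+ #|leaders S g|].

Definition stable n (G : sgraph n) (S : {set 'I_n}) : bool :=
  [forall x in S, forall y in S, ~~ G x y].

(** This is $e$ for empty [K] and $e_c$ for [K = [set c]]. *)
Definition signed_stable n (G : sgraph n) (K : {set 'I_n}) : setfun 'I_n :=
  [ffun A : {set 'I_n} => (-1) ^+ #|A| *+ stable G (K :|: A)].

Definition sinks n (g : {set 'I_n * 'I_n}) : {set 'I_n} :=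
  [set x | is_sink g x].

Lemma decreasingP n (D : {set 'I_n}) g :
  reflect (forall x y : 'I_n, x \in D -> y \in D -> (x < y)%N -> arc g y x)
          (decreasing D g).
Proof.
apply: (iffP forall_inP) => [H x y xD yD lt_xy | H x xD].
  by have /forall_inP/(_ y yD)/implyP := H x xD; apply.
by apply/forall_inP => y yD; apply/implyP; apply: H.
Qed.

Lemma stableP n (G : sgraph n) (S : {set 'I_n}) :
  reflect (forall x y, x \in S -> y \in S -> ~~ G x y) (stable G S).
Proof.
apply: (iffP forall_inP) => [H x y xS yS | H x xS].
  by have /forall_inP := H x xS; apply.
by apply/forall_inP => y; apply: H.
Qed.

Lemma sinksP n (g : {set 'I_n * 'I_n}) x :
  reflect (forall y, ~~ arc g x y) (x \in sinks g).
Proof. by rewrite inE; apply: forallP. Qed.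

Lemma is_leaderP n (g : {set 'I_n * 'I_n}) (w : 'I_n) :
  reflect (forall x : 'I_n, (x < w)%N -> ~~ connect (arc g) x w) (is_leader g w).
Proof.
apply: (iffP forallP) => H x; last by apply/implyP; apply: H.
by move=> lt_xw; have /implyP := H x; apply.
Qed.

(** Expand the product over all $i$ of the factors $1 - [i \in B]$. *)
Lemma sum_signed_subsets (T : finType) (B : {set T}) :
  \sum_(A : {set T} | A \subset B) (-1) ^+ #|A| = (B == set0)%:R :> int.
Proof.
transitivity (\prod_(i : T) (- (i \in B)%:R + 1) : int).
  rewrite bigA_distr big_mkcond /=; apply: eq_bigr => A _.
  case: (boolP (A \subset B)) => [AB|/subsetPn[x xA xB]]; last first.
    by rewrite (bigD1 x) //= xA (negPf xB) oppr0 mul0r.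
  rewrite -big_mkcond /= -prodr_const; apply: eq_bigr => x xA.
  by rewrite (subsetP AB).
have [->|/set0Pn[x xB]] := eqVneq B set0.
  by apply: big1 => x _; rewrite inE oppr0 add0r.
by rewrite (bigD1 x) //= xB addNr mul0r.
Qed.

Lemma acyclic_orientation_stable n (G : sgraph n) P g :
  stable G P -> acyclic_orientation G P g = (g == set0).
Proof.
move=> /stableP stP; apply/idP/eqP => [og|->].
  apply/setP => -[x y]; rewrite inE; apply/negP => gxy.
  have [Gxy xP yP] := acyclic_orientation_arc og gxy.
  by have := stP _ _ xP yP; rewrite Gxy.
apply/andP; split; first by apply/forallP => x; apply/forallP => y; rewrite /arc inE.
apply/forallP => x; apply/forallP => y; rewrite /arc !inE /= eq_sym.
by apply/eqP/and3P => -[Gxy xP yP]; have := stP _ _ xP yP; rewrite Gxy.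
Qed.

Lemma connect_restr_top n (G : sgraph n) (P Q : {set 'I_n}) g x w :
  acyclic_orientation G (P :|: Q) g -> no_arc P Q g -> w \in Q ->
  connect (arc (restr Q g)) x w = connect (arc g) x w.
Proof.
move=> og na wQ; apply/idP/idP => [/connect_restrW //|cxw].
by have /andP[] := connect_restr_bwd (fun u v => no_arc_bwd og na) wQ cxw.
Qed.

(** [Q] is closed under predecessors, so a path ending in [Q] lies in [Q] entirely. *)
Lemma leaders_restr n (G : sgraph n) (P Q S : {set 'I_n}) g :
  acyclic_orientation G (P :|: Q) g -> no_arc P Q g -> S \subset Q ->
  leaders S (restr Q g) = leaders S g.
Proof.
move=> og na SQ; apply/setP => w; rewrite !inE; apply: andb_id2l => wS.
apply: eq_forallb => x; rewrite (connect_restr_top _ og na) //.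
exact: (subsetP SQ).
Qed.

(** An orientation of what remains after removing [K :|: A] extends in one way to an orientation
    with [K :|: A] among its sinks, provided that this set is stable; an unstable set never consists
    of sinks. The condition on [K] allows only the empty set or the least vertex of [D], so making
    [K] sinks agrees with being decreasing on [D]. *)
Lemma signed_stable_mul_leader_sum n (G : sgraph n) (D K S : {set 'I_n}) k :
  [disjoint D & S] -> K \subset D ->
  (forall x y : 'I_n, x \in K -> y \in D -> x != y -> (x < y)%N && G x y) ->
  (signed_stable G K * leader_sum G (D :\: K) k) S =
  \sum_(g | dec_orientation G D S g)
    \sum_(A : {set 'I_n} | (A \subset S) && (K :|: A \subset sinks g))
      (-1) ^+ #|A| * k%:R ^+ #|leaders (S :\: A) g|.
Proof.
move=> dDS KD HK; rewrite setfunM.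
rewrite [RHS](exchange_big_dep (fun A : {set 'I_n} => A \subset S)) /=; last first.
  by move=> g A _ /andP[].
apply: eq_bigr => A AS; rewrite !ffunE.
rewrite [RHS](eq_bigl (fun g => dec_orientation G D S g && (K :|: A \subset sinks g)));
  last by move=> g; rewrite AS.
have [stP|nstP] := boolP (stable G (K :|: A)); last first.
  rewrite mulr0n mul0r big1 // => g /andP[/andP[og _] /subsetP sP].
  case/negP: nstP; apply/stableP => x y xP yP; apply/negP => Gxy.
  have PV z : z \in K :|: A -> z \in D :|: S.
    by rewrite !inE => /orP[/(subsetP KD)|/(subsetP AS)] ->; rewrite ?orbT.
  have := acyclic_orientationE x y og; rewrite Gxy !PV //=.
  by rewrite (negPf (sinksP _ _ (sP _ xP) _)) (negPf (sinksP _ _ (sP _ yP) _)).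
rewrite mulr1n mulr_sumr.
set P := K :|: A; set Q := (D :\: K) :|: (S :\: A).
have dPQ : [disjoint P & Q].
  rewrite disjoint_subset; apply/subsetP => x; rewrite !inE => /orP[xK|xA].
    by rewrite xK (disjointFr dDS (subsetP KD _ xK)) andbF.
  by rewrite xA (disjointFl dDS (subsetP AS _ xA)) !andbF.
have ePQ : P :|: Q = D :|: S.
  apply/setP => x; rewrite !inE.
  have [xK|_] := boolP (x \in K); first by rewrite (subsetP KD _ xK).
  by have [xA|//] := boolP (x \in A); rewrite (subsetP AS _ xA) !orbT.
(* The order condition moves into the summand to fit the shape of [sum_stack]. The stable set [P]
   contributes only the empty orientation. *)
pose F (g1 g2 : {set 'I_n * 'I_n}) : int := if decreasing (D :\: K) g2 then
  (-1) ^+ #|A| * k%:R ^+ #|leaders (S :\: A) g2| else 0.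
transitivity (\sum_(h | acyclic_orientation G Q h) F set0 h).
  by rewrite /F -big_mkcondr; apply: eq_bigl.
transitivity (\sum_(g | acyclic_orientation G P g)
    \sum_(h | acyclic_orientation G Q h) F g h).
  by rewrite (eq_bigl _ _ (fun g => acyclic_orientation_stable g stP)) big_pred1_eq.
rewrite -sum_stack // ePQ /F -big_mkcondr /=; apply: eq_big => g; last first.
  case/andP=> /andP[og na] _; rewrite -ePQ in og.
  by rewrite (leaders_restr og na) // subsetUr.
rewrite /dec_orientation -!(andbA (acyclic_orientation _ _ _)); apply: andb_id2l => og.
have ePQin x : (x \in D :|: S) = (x \in P) || (x \in Q) by rewrite -ePQ inE.
apply/andP/andP => [[/no_arcP na /decreasingP dec]|[/decreasingP dec /subsetP sP]].
  have sP : P \subset sinks g.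
    apply/subsetP => x xP; apply/sinksP => y; apply/negP => gxy.
    have [Gxy _] := acyclic_orientation_arc og gxy; rewrite ePQin => /orP[yP|yQ].
      by have /stableP/(_ _ _ xP yP) := stP; rewrite Gxy.
    by have := na _ _ xP yQ; rewrite gxy.
  split=> //; apply/decreasingP => x y xD yD lt_xy.
  have nyx : y != x by apply: contraTneq lt_xy => ->; rewrite ltnn.
  have [yK|yK] := boolP (y \in K).
    by have /andP[] := HK _ _ yK xD nyx; rewrite ltnNge ltnW.
  have [xK|xK] := boolP (x \in K); last first.
    by have := dec x y; rewrite !inE xK yK xD yD arc_restr => /(_ isT isT lt_xy)/and3P[].
  have /andP[_ Gxy] : (x < y)%N && G x y by apply: HK => //; rewrite eq_sym.
  have := acyclic_orientationE x y og; rewrite Gxy !inE xD yD /=.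
  have /sinksP/(_ y)/negPf -> // : x \in sinks g.
  by apply: (subsetP sP); rewrite inE xK.
split.
  by apply/no_arcP => x y xP _; have /sinksP := sP _ xP; apply.
apply/decreasingP => x y xDK yDK lt_xy; rewrite arc_restr.
have [xD yD] : x \in D /\ y \in D by move: xDK yDK; rewrite !inE => /andP[_ ->] /andP[_ ->].
by rewrite dec //= ![_ \in Q]inE xDK yDK.
Qed.

(** The signs over sets [A] of sinks in [S] cancel unless [S] contains no sink. The hypothesis on
    leaders makes the weight independent of [A]: it holds for [k = 1], and also when no sink in [S]
    is a leader. *)
Lemma sinkless_leader_sum n (G : sgraph n) (D K S : {set 'I_n}) k :
  [disjoint D & S] -> K \subset D ->
  (forall x y : 'I_n, x \in K -> y \in D -> x != y -> (x < y)%N && G x y) ->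
  (forall g (A : {set 'I_n}), dec_orientation G D S g -> A \subset S :&: sinks g ->
     k%:R ^+ #|leaders (S :\: A) g| = k%:R ^+ #|leaders S g| :> int) ->
  (signed_stable G K * leader_sum G (D :\: K) k) S =
  \sum_(g | dec_orientation G D S g && (K \subset sinks g) && (S :&: sinks g == set0))
     k%:R ^+ #|leaders S g|.
Proof.
move=> dDS KD HK Hk; rewrite signed_stable_mul_leader_sum //.
rewrite [RHS]big_mkcondr [RHS]big_mkcondr /=; apply: eq_bigr => g og.
have [Ks|nKs] := boolP (K \subset sinks g); last first.
  by rewrite big_pred0 // => A; rewrite subUset (negPf nKs) andbF.
transitivity (\sum_(A : {set 'I_n} | A \subset S :&: sinks g)
    (-1) ^+ #|A| * k%:R ^+ #|leaders S g| : int).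
  apply: eq_big => A; first by rewrite subUset Ks subsetI.
  by rewrite subUset -subsetIidl => /andP[AS /andP[_ As]]; rewrite Hk // subsetI AS.
rewrite -mulr_suml sum_signed_subsets.
by case: eqP => _; rewrite ?mul1r ?mul0r.
Qed.

(** * Acyclic orientations with a prescribed order on a clique *)

Definition clique n (G : sgraph n) (D : {set 'I_n}) : Prop :=
  forall x y, x \in D -> y \in D -> x != y -> G x y.

(** The function $a$: with weight 1 and empty [D], every acyclic orientation of $G[S]$ counts
    once. *)
Definition acyclic_count n (G : sgraph n) : setfun 'I_n := leader_sum G set0 1.

Definition reached n (D : {set 'I_n}) (g : {set 'I_n * 'I_n}) : {set 'I_n} :=
  [set y | [exists x in D, connect (arc g) x y]].

Definition reach_count n (G : sgraph n) (D : {set 'I_n}) : setfun 'I_n :=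
  [ffun U : {set 'I_n} =>
     \sum_(g | dec_orientation G D U g && (U \subset reached D g)) 1].

Lemma acyclic_orientation_sink n (G : sgraph n) (S : {set 'I_n}) g x :
  acyclic_orientation G S g -> x \in S -> exists2 y, y \in S & y \in sinks g.
Proof.
(* A vertex that reaches the fewest vertices is a sink, since an out-neighbor would reach strictly
   fewer. *)
move=> og xS; case: (arg_minnP (fun y => #|reachable g y|) xS) => y yS ymin.
exists y => //; apply/sinksP => z; apply/negP => gyz.
have [_ _ zS] := acyclic_orientation_arc og gyz.
suff : (#|reachable g z| < #|reachable g y|)%N by rewrite ltnNge ymin.
apply: proper_card; apply/properP; split.
  by apply/subsetP => t; rewrite !inE; apply: connect_trans (connect1 gyz).
exists y; first by rewrite inE connect0.
by rewrite inE (acyclic_arc (acyclic_orientation_acyclic og) gyz).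
Qed.

Lemma dec_orientation_set0 n (G : sgraph n) g :
  dec_orientation G set0 set0 g = (g == set0).
Proof.
rewrite /dec_orientation setU0 acyclic_orientation_stable; last first.
  by apply/stableP => x y; rewrite inE.
by apply: andb_idr => _; apply/decreasingP => x y; rewrite inE.
Qed.

Lemma dec_orientation_set1 n (G : sgraph n) w (S : {set 'I_n}) g :
  dec_orientation G set0 (w |: S) g = dec_orientation G [set w] S g.
Proof.
rewrite /dec_orientation set0U; congr (_ && _).
transitivity true; first by apply/decreasingP => x y; rewrite inE.
by apply/esym/decreasingP => x y /set1P -> /set1P ->; rewrite ltnn.
Qed.

(** An acyclic orientation of a non-empty graph has a sink, so the sinkless sum is empty unless [S]
    is. *)
Lemma signed_stable_acyclic_count n (G : sgraph n) :
  signed_stable G set0 * acyclic_count G = 1.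
Proof.
apply/ffunP => S; rewrite -[acyclic_count G]/(leader_sum G set0 1).
rewrite -[X in leader_sum G X](set0D set0).
rewrite sinkless_leader_sum ?sub0set ?disjoints_subset ?sub0set //; first last.
- by move=> g A _ _; rewrite !expr1n.
- by move=> x y; rewrite in_set0.
rewrite setfun1; have [->|/set0Pn[x xS]] := eqVneq S set0.
  rewrite (big_pred1 set0) ?expr1n // => g.
  by rewrite dec_orientation_set0 set0I eqxx sub0set !andbT.
rewrite big_pred0 // => g; apply/negP => /andP[/andP[/andP[og _] _] /eqP/setP e0].
rewrite set0U in og; have [y yS ys] := acyclic_orientation_sink og xS.
by have := e0 y; rewrite in_setI yS ys inE.
Qed.

(** Both sides count the orientations decreasing on [D] without a sink in [S]. Some sink exists, it
    lies in [D], and every other vertex of [D] points to [c]; so [c] is automatically a sink. *)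
Lemma leader_sum_clique_step n (G : sgraph n) (D S : {set 'I_n}) c :
  clique G D -> c \in D -> (forall x, x \in D -> (c <= x)%N) -> [disjoint D & S] ->
  (signed_stable G set0 * leader_sum G D 1) S =
  (signed_stable G [set c] * leader_sum G (D :\ c) 1) S.
Proof.
move=> cl cD cmin dDS; rewrite -[D in LHS]setD0.
rewrite !sinkless_leader_sum ?sub0set ?sub1set //; first last.
- by move=> g A _ _; rewrite !expr1n.
- move=> x y /set1P -> yD ncy; rewrite cl // andbT ltn_neqAle cmin // andbT.
  exact: ncy.
- by move=> g A _ _; rewrite !expr1n.
- by move=> x y; rewrite in_set0.
apply: eq_bigl => g; rewrite sub0set andbT.
have [/andP[og /decreasingP dec]|//] := boolP (dec_orientation _ _ _ _).
rewrite andTb andb_idl // => /eqP e0; rewrite sub1set.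
have cDS : c \in D :|: S by rewrite inE cD.
have [y + ys] := acyclic_orientation_sink og cDS; rewrite inE => /orP[yD|yS].
  have [<- //|nyc] := eqVneq y c.
  have := sinksP _ _ ys c; rewrite dec //.
  by rewrite ltn_neqAle cmin // andbT eq_sym.
by have := in_set0 y; rewrite -e0 inE yS ys.
Qed.

Lemma exists_min n (D : {set 'I_n}) :
  D != set0 -> exists2 c, c \in D & forall x, x \in D -> (c <= x)%N.
Proof.
by case/set0Pn=> x xD; case: (arg_minnP val xD) => c cD cmin; exists c.
Qed.

(** Removing the least clique vertex [c] trades the factor $e$ for $e_c$; multiplying by $a$ cancels
    $e$. Thus each clique vertex contributes $e_c a$. *)
Lemma leader_sum_clique1 n (G : sgraph n) (D S : {set 'I_n}) :
  clique G D -> [disjoint D & S] ->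
  leader_sum G D 1 S =
  (\prod_(c in D) signed_stable G [set c] * acyclic_count G ^+ #|D|.+1) S.
Proof.
elim: {D}_.+1 {-2}D (ltnSn #|D|) S => // m IHm D lt_Dm S cl dDS.
have [->|D0] := eqVneq D set0; first by rewrite big_set0 cards0 mul1r expr1.
have [c cD cmin] := exists_min D0.
have cl' : clique G (D :\ c).
  by move=> x y /setD1P[_ xD] /setD1P[_ yD]; apply: cl.
have eD : #|D| = #|D :\ c|.+1 by rewrite (cardsD1 c) cD.
transitivity ((acyclic_count G * (signed_stable G set0 * leader_sum G D 1)) S).
  by rewrite mulrA [_ * signed_stable _ _]mulrC signed_stable_acyclic_count mul1r.
transitivity ((acyclic_count G * (signed_stable G [set c] *
   (\prod_(x in D :\ c) signed_stable G [set x] * acyclic_count G ^+ #|D|))) S).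
  apply: setfun_mul_local => // A AS.
  have dDA : [disjoint D & A] by apply: disjointWr dDS.
  rewrite (leader_sum_clique_step cl cD cmin dDA).
  apply: setfun_mul_local => // B BA; rewrite eD IHm -?eD //.
  by apply: disjointWr BA _; apply: disjointWl dDA; apply: subsetDl.
by rewrite [in RHS](big_setD1 c) //= exprS [in RHS]mulrCA -!mulrA.
Qed.

(** Sort orientations by the set [U] of vertices of [S] reached from [D]. No arc leaves [D :|: U],
    so the orientation splits there. A vertex of [U] is reached from a smaller vertex and is no
    leader, and outside [U] leadership is unaffected by the split. *)
Lemma leader_sum_reach n (G : sgraph n) (D S : {set 'I_n}) k :
  (forall x y : 'I_n, x \in D -> y \in S -> (x < y)%N) ->
  leader_sum G D k S = (reach_count G D * leader_sum G set0 k) S.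
Proof.
move=> lt_DS; rewrite setfunM ffunE.
have dDS : [disjoint D & S].
  rewrite disjoint_subset; apply/subsetP => x xD; rewrite inE; apply/negP => xS.
  by have := lt_DS _ _ xD xS; rewrite ltnn.
rewrite (partition_big (fun g => S :&: reached D g) (fun U => U \subset S)) /=;
  last by move=> g _; rewrite subsetIl.
apply: eq_bigr => U US; rewrite !ffunE.
set P := D :|: U; set Q := S :\: U.
have dPQ : [disjoint P & Q].
  rewrite disjoint_subset; apply/subsetP => x; rewrite !inE => /orP[xD|->//].
  by rewrite (disjointFr dDS xD) andbF.
have ePQ : P :|: Q = D :|: S.
  rewrite -setUA; congr (_ :|: _); apply/setP => x; rewrite !inE.
  by have [/(subsetP US) ->|] := boolP (x \in U).
have no_arcS g : S :&: reached D g = U -> no_arc P Q g.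
  move=> eU; apply/no_arcP => x y xP; rewrite inE => /andP[yU yS].
  apply: contra yU => gxy; rewrite -eU inE yS inE.
  have [xD|xD] := boolP (x \in D).
    by apply/exists_inP; exists x => //; apply: connect1.
  move: xP; rewrite inE (negPf xD) -eU !inE => /andP[_ /exists_inP[z zD czx]].
  by apply/exists_inP; exists z => //; apply: connect_trans czx (connect1 gxy).
pose F (g1 g2 : {set 'I_n * 'I_n}) : int :=
  if decreasing D g1 && (U \subset reached D g1) then k%:R ^+ #|leaders Q g2| else 0.
transitivity (\sum_(g | acyclic_orientation G P g)
    \sum_(h | acyclic_orientation G Q h) F g h); last first.
  rewrite mulr_suml [RHS](eq_bigl (fun g => acyclic_orientation G P g &&
    (decreasing D g && (U \subset reached D g)))); last by move=> g; rewrite -andbA.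
  rewrite [RHS]big_mkcondr /=; apply: eq_bigr => g _; rewrite /F.
  case: ifP => _; last by rewrite big1.
  rewrite mul1r; apply: eq_bigl => h.
  rewrite /dec_orientation set0U andb_idr // => _.
  by apply/decreasingP => x y; rewrite inE.
rewrite -sum_stack // ePQ /F -big_mkcondr /=; apply: eq_big => g; last first.
  case/andP=> /andP[og _] /eqP eU; congr (_ ^+ #|pred_of_set _|).
  have naP := no_arcS g eU.
  rewrite -ePQ in og; rewrite (leaders_restr og naP) //.
  apply/setP => w; rewrite !inE; have [wU|//] := boolP (w \in U).
  apply/andP => -[wS /is_leaderP lw]; move: wU; rewrite -eU !inE.
  case/andP=> _ /exists_inP[x xD cxw].
  by have := lw _ (lt_DS _ _ xD wS); rewrite cxw.
rewrite /dec_orientation -!(andbA (acyclic_orientation _ _ _)); apply: andb_id2l => og.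
have og' := og; rewrite -ePQ in og'.
have DP x : x \in D -> x \in P by rewrite inE => ->.
apply/andP/and3P => [[/decreasingP dec /eqP eU]|[na /decreasingP dec /subsetP rU]].
  have na := no_arcS g eU.
  split=> //.
    by apply/decreasingP => x y xD yD lt_xy; rewrite arc_restr dec //= !DP.
  apply/subsetP => u uU; move: (uU); rewrite -eU !inE => /andP[_ /exists_inP[x xD cxu]].
  apply/exists_inP; exists x => //.
  by have /andP[] := connect_restr_fwd (fun _ _ => no_arc_fwd og' na) (DP _ xD) cxu.
split.
  by apply/decreasingP => x y xD yD lt_xy; 
     have := dec _ _ xD yD lt_xy; rewrite arc_restr => /and3P[].
apply/eqP/setP => y; rewrite inE; apply/andP/idP => [[yS]|yU].
  rewrite inE => /exists_inP[x xD cxy].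
  have /andP[] := connect_restr_fwd (fun _ _ => no_arc_fwd og' na) (DP _ xD) cxy.
  by rewrite inE (disjointFl dDS yS).
split; first exact: (subsetP US).
have := rU _ yU; rewrite !inE => /exists_inP[x xD /connect_restrW cxy].
by apply/exists_inP; exists x.
Qed.

(** The least vertex [w] is always a leader and accounts for the factor [k]. *)
Lemma leader_sum_min n (G : sgraph n) (w : 'I_n) (S : {set 'I_n}) k :
  (forall y : 'I_n, y \in S -> (w < y)%N) ->
  leader_sum G set0 k (w |: S) = k%:R * leader_sum G [set w] k S.
Proof.
move=> lt_wS; rewrite !ffunE mulr_sumr; apply: eq_big => g.
  exact: dec_orientation_set1.
case/andP=> og _; rewrite -exprS; congr (_ ^+ _).
have wS : w \notin S by apply/negP => wS; have := lt_wS _ wS; rewrite ltnn.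
have -> : leaders (w |: S) g = w |: leaders S g.
  apply/setP => x; rewrite !inE; case: eqVneq => //= ->.
  apply/is_leaderP => y lt_yw; apply/negP => /connectP[[|z p] /= pth ey].
    by rewrite ey ltnn in lt_yw.
  have /andP[gyz _] := pth; have [_ + _] := acyclic_orientation_arc og gyz.
  rewrite set0U !inE => /orP[/eqP eyw|yS]; first by rewrite eyw ltnn in lt_yw.
  by have := lt_wS _ yS; rewrite ltnNge ltnW.
by rewrite cardsU1 inE (negPf wS).
Qed.

(** * Powers of the acyclic orientation count *)

Lemma acyclic_countU1 n (G : sgraph n) w (S : {set 'I_n}) :
  w \notin S ->
  acyclic_count G (w |: S) = (signed_stable G [set w] * acyclic_count G ^+ 2) S.
Proof.
move=> wS; transitivity (leader_sum G [set w] 1 S).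
  rewrite !ffunE; apply: eq_big => g; first exact: dec_orientation_set1.
  by rewrite !expr1n.
rewrite leader_sum_clique1 ?disjoints1 ?cards1 ?big_set1 //.
by move=> x y /set1P -> /set1P ->; rewrite eqxx.
Qed.

(** The power rule $(a^k)' = k a^{k-1} a'$ with $a' = e_w a^2$. *)
Lemma acyclic_count_expU1 n (G : sgraph n) w (S : {set 'I_n}) k :
  w \notin S ->
  (acyclic_count G ^+ k) (w |: S) =
  k%:R * (signed_stable G [set w] * acyclic_count G ^+ k.+1) S.
Proof.
elim: k S => [|k IHk] S wS.
  rewrite expr0 setfun1 mul0r; case: eqP => // /setP/(_ w).
  by rewrite !inE eqxx.
rewrite exprS setfun_derivM // setfunD.
transitivity ((signed_stable G [set w] * acyclic_count G ^+ 2 * acyclic_count G ^+ k) S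
  + (acyclic_count G * (signed_stable G [set w] * acyclic_count G ^+ k.+1 *+ k)) S).
  congr (_ + _); apply: setfun_mul_local => // A AS; rewrite ffunE.
    by rewrite acyclic_countU1 //; apply: contra wS; apply: (subsetP AS).
  rewrite IHk ?setfunMn ?mulr_natl //; apply: contra wS; apply: (subsetP AS).
rewrite mulrnAr setfunMn -mulrA -exprD add2n.
rewrite [acyclic_count G * (_ * _)]mulrCA -exprS.
by rewrite -mulrS mulr_natl.
Qed.

Lemma setfunX0 (T : finType) (f : setfun T) k : (f ^+ k) set0 = f set0 ^+ k.
Proof.
elim: k => [|k IHk]; first by rewrite setfun1 eqxx.
rewrite !exprS setfunM (big_pred1 set0) ?set0D ?IHk // => A.
by rewrite subset0.
Qed.

(** At weight 1, [leader_sum_reach] and [leader_sum_clique1] evaluate the same sum; multiplying by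
    $e$ cancels one factor $a$. *)
Lemma reach_countE n (G : sgraph n) (D S : {set 'I_n}) :
  clique G D -> (forall x y : 'I_n, x \in D -> y \in S -> (x < y)%N) ->
  reach_count G D S =
  (\prod_(c in D) signed_stable G [set c] * acyclic_count G ^+ #|D|) S.
Proof.
move=> cl lt_DS.
transitivity ((reach_count G D * acyclic_count G * signed_stable G set0) S).
  by rewrite -mulrA [_ * signed_stable _ _]mulrC signed_stable_acyclic_count mulr1.
transitivity ((\prod_(c in D) signed_stable G [set c] * acyclic_count G ^+ #|D|.+1
   * signed_stable G set0) S).
  apply: setfun_mul_local => // A AS.
  have lt_DA x y : x \in D -> y \in A -> (x < y)%N.
    by move=> xD /(subsetP AS); apply: lt_DS.
  rewrite -[acyclic_count G in LHS]/(leader_sum G set0 1) -leader_sum_reach //.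
  rewrite leader_sum_clique1 // disjoint_subset; apply/subsetP => x xD.
  by rewrite inE; apply/negP => /(lt_DA _ _ xD); rewrite ltnn.
by rewrite exprSr -!mulrA [acyclic_count G * _]mulrC signed_stable_acyclic_count mulr1.
Qed.

(** Induction on the size of [S]: with [w] the least vertex, both sides equal $k (e_w a^{k+1})(S
    \setminus w)$, one by splitting off what [w] reaches and the other by the power rule. *)
Lemma leader_sum_set0 n (G : sgraph n) k :
  leader_sum G set0 k = acyclic_count G ^+ k.
Proof.
apply/ffunP => S; elim: {S}_.+1 {-2}S (ltnSn #|S|) => // m IHm S lt_Sm.
have [->|S0] := eqVneq S set0.
  rewrite setfunX0 !ffunE !(big_pred1 set0) //=; try exact: dec_orientation_set0.
  have -> : leaders set0 set0 = set0 :> {set 'I_n} by apply/setP => x; rewrite !inE.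
  by rewrite cards0 !expr0 expr1n.
have [w wS wmin] := exists_min S0.
have lt_w y : y \in S :\ w -> (w < y)%N.
  by case/setD1P=> nyw yS; rewrite ltn_neqAle wmin // andbT eq_sym.
rewrite -(setD1K wS) leader_sum_min // acyclic_count_expU1 ?setD11 //.
congr (_ * _); rewrite leader_sum_reach; last by move=> x y /set1P ->; apply: lt_w.
transitivity ((signed_stable G [set w] * acyclic_count G * acyclic_count G ^+ k) (S :\ w));
  last by rewrite -mulrA -exprS.
apply: setfun_mul_local => A AS.
  rewrite reach_countE ?big_set1 ?cards1 ?expr1 //.
    by move=> x y /set1P -> /set1P ->; rewrite eqxx.
  by move=> x y /set1P -> /(subsetP AS); apply: lt_w.
apply: IHm; apply: leq_ltn_trans (subset_leq_card AS) _.
by move: lt_Sm; rewrite (cardsD1 w) wS.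
Qed.

Lemma leader_sum_clique n (G : sgraph n) (D S : {set 'I_n}) k :
  clique G D -> (forall x y : 'I_n, x \in D -> y \in S -> (x < y)%N) ->
  leader_sum G D k S =
  (\prod_(c in D) signed_stable G [set c] * acyclic_count G ^+ (#|D| + k)) S.
Proof.
move=> cl lt_DS; rewrite leader_sum_reach // leader_sum_set0 exprD mulrA.
apply: setfun_mul_local => // A AS; apply: reach_countE => // x y xD yA.
by apply: lt_DS => //; apply: (subsetP AS).
Qed.

(** A set containing a neighbor of [c] is never stable together with [c]; so $e_c$ is a constant for
    the derivative at another clique vertex. *)
Lemma signed_stable_deriv0 n (G : sgraph n) c w :
  G c w -> setfun_deriv w (signed_stable G [set c]) = 0.
Proof.
move=> Gcw; apply/ffunP => A; rewrite !ffunE.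
case: stableP => [/(_ c w)|_]; last by rewrite mulr0n.
by rewrite !inE !eqxx !orbT Gcw => /(_ isT isT).
Qed.

Lemma setfun_deriv1 (T : finType) (w : T) : setfun_deriv w 1 = 0.
Proof.
apply/ffunP => A; rewrite !ffunE; case: eqP => // /setP/(_ w).
by rewrite !inE eqxx.
Qed.

(** Differentiate along the clique vertices in turn: the factors $e_c$ are constants, and each step
    turns $a^m$ into $m e_w a^{m+1}$. The exponents build up the rising factorial $k (k+1) \cdots
    (k+d-1)$, where $d$ is the size of [D]. *)
Lemma acyclic_count_exp_clique n (G : sgraph n) (D S : {set 'I_n}) k :
  clique G D -> [disjoint D & S] ->
  (acyclic_count G ^+ k) (D :|: S) =
  (\prod_(j < #|D|) (k + j)%:R) *
  (\prod_(c in D) signed_stable G [set c] * acyclic_count G ^+ (k + #|D|)) S.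
Proof.
elim: {D}_.+1 {-2}D (ltnSn #|D|) S => // m IHm D lt_Dm S cl dDS.
have [->|/set0Pn[w wD]] := eqVneq D set0.
  by rewrite set0U big_set0 cards0 big_ord0 !mul1r addn0.
set D' := D :\ w; have eD : #|D| = #|D'|.+1 by rewrite (cardsD1 w) wD.
have wS : w \notin S by rewrite (disjointFr dDS wD).
have cl' : clique G D' by move=> x y /setD1P[_ xD] /setD1P[_ yD]; apply: cl.
have -> : D :|: S = D' :|: (w |: S) by rewrite -[in LHS](setD1K wD) setUA [_ :|: [set w]]setUC.
rewrite IHm -?eD //; last first.
  rewrite disjoint_subset; apply/subsetP => x; rewrite !inE negb_or => /andP[-> xD].
  by rewrite (disjointFr dDS xD).
rewrite eD big_ord_recr /= -mulrA; congr (_ * _).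
rewrite setfun_derivM //.
have -> : setfun_deriv w (\prod_(c in D') signed_stable G [set c]) = 0.
  elim/big_ind: _ => [|f g|c /setD1P[ncw cD]]; first exact: setfun_deriv1.
    exact: setfun_deriv_mul0.
  by apply: signed_stable_deriv0; apply: cl.
rewrite mul0r add0r [in RHS](big_setD1 w) //= -/D'.
transitivity ((\prod_(c in D') signed_stable G [set c] *
  (signed_stable G [set w] * acyclic_count G ^+ (k + #|D'|).+1 *+ (k + #|D'|))) S).
  apply: setfun_mul_local => // A AS; rewrite ffunE acyclic_count_expU1.
    by rewrite setfunMn mulr_natl.
  by apply: contra wS; apply: (subsetP AS).
rewrite mulrnAr setfunMn addnS mulr_natl mulrA.
by rewrite [signed_stable G [set w] * _]mulrC.
Qed.

(** * Colorings and reciprocity *)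

(* The colors of the vertices outside [S] are frozen to the junk value [z]. *)
Definition partial_coloring n (G : sgraph n) K (z : 'I_K) (j : nat)
    (S : {set 'I_n}) (f : {ffun 'I_n -> 'I_K}) : bool :=
  [forall x, if x \in S then (f x < j)%N else f x == z] &&
  [forall x in S, forall y in S, G x y ==> (f x != f y)].

Lemma partial_coloringP n (G : sgraph n) K (z : 'I_K) j (S : {set 'I_n})
    (f : {ffun 'I_n -> 'I_K}) :
  reflect [/\ forall x, x \in S -> (f x < j)%N, forall x, x \notin S -> f x = z
    & forall x y, x \in S -> y \in S -> G x y -> f x != f y]
  (partial_coloring G z j S f).
Proof.
apply: (iffP andP) => [[/forallP H1 /forall_inP H2]|[H1 H2 H3]]; split.
- by move=> x xS; have := H1 x; rewrite xS.
- by move=> x /negPf xS; have := H1 x; rewrite xS => /eqP.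
- by move=> x y xS yS Gxy; have /forall_inP/(_ y yS)/implyP := H2 x xS; apply.
- by apply/forallP => x; case: ifPn => [/H1|/H2 ->].
- apply/forall_inP => x xS; apply/forall_inP => y yS; apply/implyP.
  exact: H3.
Qed.

(** The first factor of the power selects the stable class of the last color [j], and the rest uses
    the colors below [j]. The fixed bound [K] keeps one type of colorings throughout the
    induction. *)
Lemma signed_stable_exp n (G : sgraph n) K (z : 'I_K) j (S : {set 'I_n}) :
  (j <= K)%N ->
  (signed_stable G set0 ^+ j) S =
  (-1) ^+ #|S| * \sum_(f | partial_coloring G z j S f) 1.
Proof.
elim: j S => [|j IHj] S lt_jK.
  rewrite setfun1; have [->|/set0Pn[x xS]] := eqVneq S set0.
    rewrite cards0 mul1r (big_pred1 [ffun => z]) // => f.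
    apply/partial_coloringP/eqP => [[_ Hf _]|->].
      by apply/ffunP => x; rewrite ffunE Hf ?inE.
    by split=> x; rewrite ?inE // ffunE.
  rewrite big_pred0 ?mulr0 // => f; apply/partial_coloringP => -[/(_ x xS)].
  by rewrite ltn0.
pose cl (f : {ffun 'I_n -> 'I_K}) := [set x in S | f x == Ordinal lt_jK].
rewrite exprS setfunM (partition_big cl (fun A => A \subset S)) /=; last first.
  by move=> f _; apply/subsetP => x; rewrite inE => /andP[].
rewrite mulr_sumr; apply: eq_bigr => A AS.
rewrite (IHj _ (ltnW lt_jK)) ffunE set0U.
have -> : (-1) ^+ #|S| = (-1) ^+ #|A| * (-1) ^+ #|S :\: A| :> int.
  by rewrite -exprD -(cardsID A S) (setIidPr AS).
have [stA|nstA] := boolP (stable G A); last first.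
  rewrite mulr0n mul0r big_pred0 ?mulr0 // => f; apply/negP.
  case/andP=> /partial_coloringP[_ _ Hf] /eqP eA; case/negP: nstA.
  apply/stableP => x y xA yA; apply/negP => Gxy.
  have := Hf _ _ (subsetP AS _ xA) (subsetP AS _ yA) Gxy.
  by move: xA yA; rewrite -eA !inE => /andP[_ /eqP ->] /andP[_ /eqP ->]; rewrite eqxx.
rewrite mulr1n mulrA; congr (_ * _).
(* Erasing the last color on [A] to the junk value is undone by painting [A] with it again. *)
rewrite (reindex_onto (fun f : {ffun 'I_n -> 'I_K} => [ffun x => if x \in A then z else f x])
  (fun f : {ffun 'I_n -> 'I_K} => [ffun x => if x \in A then Ordinal lt_jK else f x])) /=;
  last first.
  move=> f /partial_coloringP[_ Hf _]; apply/ffunP => x; rewrite !ffunE.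
  by have [xA|//] := boolP (x \in A); apply/esym/Hf; rewrite inE xA.
apply: eq_bigl => f.
apply/andP/andP => [[/partial_coloringP[H1 H2 H3] /eqP/ffunP ef]|].
  have fA x : x \in A -> f x = Ordinal lt_jK by move=> xA; rewrite -ef !ffunE xA.
  have fnA x : x \in S -> x \notin A -> (f x < j)%N.
    by move=> xS xA; have := H1 x; rewrite !inE xA xS ffunE (negPf xA); apply.
  split.
    apply/partial_coloringP; split.
    - move=> x xS; have [/fA -> //=|xA] := boolP (x \in A).
      by apply: ltnW; apply: fnA.
    - move=> x xS; have := H2 x; rewrite !inE (negPf xS) andbF ffunE => /(_ isT).
      by case: ifP => // /(subsetP AS); rewrite (negPf xS).
    move=> x y xS yS Gxy; rewrite -val_eqE.
    have [xA|xA] := boolP (x \in A); have [yA|yA] := boolP (y \in A).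
    - by have /stableP/(_ _ _ xA yA) := stA; rewrite Gxy.
    - by rewrite (fA x) //= neq_ltn fnA ?orbT.
    - by rewrite (fA y) //= neq_ltn fnA.
    have := H3 x y; rewrite !inE xA yA xS yS !ffunE (negPf xA) (negPf yA).
    by move=> /(_ isT isT Gxy).
  apply/eqP/setP => x; rewrite inE; apply/andP/idP => [[xS /eqP efx]|xA].
    by apply: contraT => /(fnA x xS); rewrite efx /= ltnn.
  by rewrite (subsetP AS) // fA.
case=> /partial_coloringP[H1 H2 H3] /eqP eA.
have fA x : (x \in A) = (x \in S) && (f x == Ordinal lt_jK) by rewrite -eA inE.
split; last first.
  apply/eqP/ffunP => x; rewrite !ffunE.
  by have [|//] := boolP (x \in A); rewrite fA => /andP[_ /eqP ->].
apply/partial_coloringP; split.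
- move=> x /setDP[xS xA]; rewrite ffunE (negPf xA) ltn_neqAle -ltnS H1 // andbT.
  by move: xA; rewrite fA xS.
- by move=> x; rewrite inE negb_and negbK ffunE; case: ifP => //= _ /H2.
move=> x y /setDP[xS xA] /setDP[yS yA]; rewrite !ffunE (negPf xA) (negPf yA).
exact: H3.
Qed.

Lemma signed_stable_num_colorings n (G : sgraph n) k :
  (signed_stable G set0 ^+ k) setT = (-1) ^+ n * (num_colorings G k)%:R.
Proof.
(* For [k = 0] there is no color to serve as junk value; only the empty graph then has a
   coloring. *)
case: k => [|k].
  rewrite setfun1 /num_colorings; case: n G => [|n] G.
    rewrite (_ : setT = set0); last by apply/setP => -[].
    rewrite eqxx expr0 mul1r (_ : [set _ | _] = setT) ?cardsT ?card_ffun ?card_ord //.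
    by apply/setP => f; rewrite !inE; apply/forallP => -[].
  rewrite (_ : [set _ | _] = set0) ?cards0 ?mulr0.
    by case: eqP => // /setP/(_ ord0); rewrite !inE.
  by apply/setP => f; case: (f ord0).
rewrite (@signed_stable_exp _ _ k.+1 ord0) // cardsT card_ord; congr (_ * _).
rewrite /num_colorings -sum1_card natr_sum; apply: eq_bigl => f.
rewrite inE; apply/partial_coloringP/forallP => [[_ _ Hf] x|Hf].
  by apply/forallP => y; apply/implyP; apply: Hf; rewrite inE.
split=> // [x|x y _ _]; first by rewrite inE.
by have /forallP/(_ y)/implyP := Hf x.
Qed.

(** Chromatic reciprocity: powers of $e$ count colorings up to sign, $e$ is unipotent since
    $e(\emptyset) = 1$, and $a$ is its inverse. *)
Lemma acyclic_count_exp_chromatic n (G : sgraph n) (k : nat) :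
  (acyclic_count G ^+ k) setT = (-1) ^+ n * (chromatic_poly G).[- k%:R].
Proof.
have e1 : signed_stable G set0 set0 = 1.
  rewrite ffunE cards0 setU0 (_ : stable G set0) //.
  by apply/stableP => x y; rewrite inE.
have H1 : 1 * (signed_stable G set0 - 1) ^+ #|'I_n|.+1 = 0.
  by rewrite mul1r setfun_unipotent_nil.
have H2 j : (1 * signed_stable G set0 ^+ j) setT =
    ((-1) ^+ n *: chromatic_poly G).[j%:R].
  by rewrite mul1r hornerZ chromatic_polyP signed_stable_num_colorings.
have := setfun_reciprocity (signed_stable_acyclic_count G) H1 H2 k.
by rewrite mul1r hornerZ.
Qed.

(** * Source-components and leaders *)

(** A non-recursive description of the covered sets: the union of the sets $R_y$ over the vertices
    [y] of value less than [t]. *)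
Definition below n (g : {set 'I_n * 'I_n}) (t : nat) : {set 'I_n} :=
  [set x | [exists y : 'I_n, (y < t)%N && connect (arc g) y x]].

Definition leader_comp n (g : {set 'I_n * 'I_n}) (w : 'I_n) : {set 'I_n} :=
  reachable g w :\: below g w.

Lemma belowP n (g : {set 'I_n * 'I_n}) t x :
  reflect (exists2 y : 'I_n, (y < t)%N & connect (arc g) y x) (x \in below g t).
Proof. by rewrite inE; apply: (iffP exists_inP). Qed.

Lemma is_leader_below n (g : {set 'I_n * 'I_n}) (w : 'I_n) :
  is_leader g w = (w \notin below g w).
Proof.
apply/is_leaderP/negP => [H /belowP[y lt_yw]|H y lt_yw].
  by apply/negP; apply: H.
by apply/negP => cyw; apply/H/belowP; exists y.
Qed.

Lemma belowS n (g : {set 'I_n * 'I_n}) (w : 'I_n) :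
  below g w.+1 = below g w :|: leader_comp g w.
Proof.
apply/setP => x; rewrite /leader_comp in_setU in_setD orb_andr orbN /=.
rewrite [x \in reachable g w]inE.
apply/belowP/orP => [[y]|[/belowP[y lt_yw cyx]|cwx]].
- rewrite ltnS leq_eqVlt => /orP[/eqP/val_inj -> ->|lt_yw cyx]; first by right.
  by left; apply/belowP; exists y.
- by exists y => //; apply: ltnW.
by exists w.
Qed.

Lemma next_comp_leader n (g : {set 'I_n * 'I_n}) (w : 'I_n) :
  is_leader g w -> next_comp g (below g w) = leader_comp g w.
Proof.
rewrite is_leader_below => wN; rewrite /next_comp.
case: pickP => [x0 x0N|/(_ w)]; last by rewrite inE wN.
case: arg_minnP => // m; rewrite inE => mN mmin.
suff -> : m = w by [].
apply/val_inj/eqP; rewrite eqn_leq mmin ?in_setC // leqNgt.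
by apply: contra mN => lt_mw; apply/belowP; exists m.
Qed.

(** The least uncovered vertex is at least [t], and all vertices before it are covered, so they add
    nothing to [below g t]. *)
Lemma next_comp_below n (g : {set 'I_n * 'I_n}) t :
  next_comp g (below g t) = set0 \/
  exists2 w, is_leader g w & below g t = below g w.
Proof.
rewrite {1}/next_comp; case: pickP => [x0 x0N|_]; last by left.
right; case: (@arg_minnP _ x0 (fun i => i \in ~: below g t) val x0N) => m /=.
rewrite in_setC => mN mmin.
have le_tm : (t <= m)%N.
  by rewrite leqNgt; apply: contra mN => lt_mt; apply/belowP; exists m.
suff E : below g t = below g m by exists m; rewrite // is_leader_below -E.
apply/setP => x; apply/belowP/belowP => -[y lt_y cyx].
  by exists y => //; apply: leq_trans le_tm.
have /belowP[z lt_zt czy] : y \in below g t.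
  by apply: contraTT lt_y => yN; rewrite -leqNgt mmin // in_setC.
by exists z => //; apply: connect_trans cyx.
Qed.

Lemma covered_below n (g : {set 'I_n * 'I_n}) k :
  exists t, covered g k = below g t.
Proof.
elim: k => [|k [t IHk]] /=.
  by exists 0%N; apply/setP => x; rewrite inE; apply/esym/belowP => -[].
rewrite IHk; have [->|[w lw E]] := next_comp_below g t.
  by exists t; rewrite setU0.
by exists w.+1; rewrite E next_comp_leader // -belowS.
Qed.

(** Passing a leader adds one component. Passing any other vertex adds nothing: a smaller vertex
    already reaches all that it reaches. *)
Lemma below_covered n (g : {set 'I_n * 'I_n}) t :
  (t <= n)%N -> exists k, covered g k = below g t.
Proof.
elim: t => [_|t IHt lt_tn].
  by exists 0%N; apply/setP => x; rewrite /= inE; apply/esym/belowP => -[].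
have [k Ek] := IHt (ltnW lt_tn); pose w := Ordinal lt_tn.
have [lw|] := boolP (is_leader g w).
  by exists k.+1; have := belowS g w; rewrite -(next_comp_leader lw) /= -Ek => ->.
rewrite is_leader_below negbK => /belowP[z lt_zw czw]; exists k.
rewrite Ek -[t.+1]/(val w).+1 belowS; apply/esym/setUidPl/subsetP => x.
rewrite /leader_comp !inE => /andP[_ cwx]; apply/exists_inP; exists z => //.
exact: connect_trans cwx.
Qed.

Lemma mem_leader_comp n (g : {set 'I_n * 'I_n}) (w : 'I_n) :
  is_leader g w -> w \in leader_comp g w.
Proof. by rewrite is_leader_below /leader_comp !in_setD !inE connect0 andbT. Qed.

Lemma source_componentsE n (g : {set 'I_n * 'I_n}) :
  source_components g = [set leader_comp g w | w in leaders setT g].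
Proof.
apply/setP => S; apply/source_componentsP/imsetP => [[S0 [k Ek]]|[w]].
  have [t Et] := covered_below g k; rewrite /source_comp Et in Ek.
  have [E|[w lw E]] := next_comp_below g t; first by rewrite Ek E eqxx in S0.
  by exists w; rewrite ?Ek ?E ?next_comp_leader // !inE.
rewrite inE => /andP[_ lw] ->; split.
  by apply/set0Pn; exists w; apply: mem_leader_comp.
have [k Ek] := below_covered g (ltnW (ltn_ord w)); exists k.
by rewrite /source_comp Ek next_comp_leader.
Qed.

Lemma leader_comp_inj n (g : {set 'I_n * 'I_n}) :
  {in leaders setT g &, injective (leader_comp g)}.
Proof.
move=> w w'; rewrite !inE /= => lw lw' E; apply/val_inj/eqP.
have := mem_leader_comp lw; rewrite E in_setD => /andP[/belowP H _].
have := mem_leader_comp lw'; rewrite -E in_setD => /andP[/belowP H' _].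
case: ltngtP => // lt_w; first by case: H; exists w; rewrite ?connect0.
by case: H'; exists w'; rewrite ?connect0.
Qed.

Lemma card_source_components n (g : {set 'I_n * 'I_n}) :
  #|source_components g| = #|leaders setT g|.
Proof. by rewrite source_componentsE card_in_imset //; apply: leader_comp_inj. Qed.

(** * The counted orientations as decreasing orientations without late sinks *)

Definition initial_segment n (d : nat) : {set 'I_n} := [set x : 'I_n | (x < d)%N].

(** If [g] is decreasing, the component of a leader [w] contains no initial vertex other than [w]: a
    larger one would point back to [w] and close a cycle. Conversely, an increasing arc puts its
    head in one component with a smaller initial vertex. *)
Lemma in_distinct_componentsE n (G : sgraph n) d g :
  initial_clique G d -> acyclic_orientation G setT g ->
  in_distinct_components g d = decreasing (initial_segment n d) g.
Proof.
move=> cl og; have ac := acyclic_orientation_acyclic og.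
apply/idP/decreasingP => [H x y|dec]; last first.
  apply/forall_inP => S; rewrite source_componentsE => /imsetP[w lw ->].
  have eqw (z : 'I_n) : (z < d)%N -> z \in leader_comp g w -> z = w.
    move=> lt_zd; rewrite in_setD [z \in reachable g w]inE => /andP[/belowP zN cwz].
    apply/eqP/negPn/negP => nzw.
    have le_wz : (w <= z)%N by rewrite leqNgt; apply/negP => lt_zw; apply: zN; exists z.
    have lt_wz : (w < z)%N by rewrite ltn_neqAle le_wz andbT eq_sym.
    have gzw : arc g z w by apply: dec; rewrite ?inE // (ltn_trans lt_wz).
    by rewrite (acyclic_arc ac gzw) in cwz.
  apply/forall_inP => x xS; apply/forall_inP => y yS; apply/implyP.
  by case/andP=> lt_xd lt_yd; rewrite (eqw x) // (eqw y).
rewrite !inE => lt_xd lt_yd lt_xy.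
have nxy : x != y by apply: contraTneq lt_xy => ->; rewrite ltnn.
have := acyclic_orientationE x y og; rewrite !inE cl // => /orP[gxy|//].
(* The least vertex [r] reaching [y] is a leader with [y] in its component, and [r] is at most [x],
   hence initial and distinct from [y]. *)
case: (@arg_minnP _ x (fun z => connect (arc g) z y) val (connect1 gxy)) => r cry rmin.
have le_rx : (r <= x)%N by apply: rmin; apply: connect1.
have lr : is_leader g r.
  apply/is_leaderP => z lt_zr; apply/negP => czr.
  by have := rmin _ (connect_trans czr cry); rewrite leqNgt lt_zr.
have yr : y \in leader_comp g r.
  rewrite in_setD [y \in reachable g r]inE cry andbT; apply/belowP => -[z lt_zr czy].
  by have := rmin _ czy; rewrite leqNgt lt_zr.
have rS : leader_comp g r \in source_components g.
  by rewrite source_componentsE imset_f // inE inE.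
have /forall_inP/(_ _ (mem_leader_comp lr)) := forall_inP H _ rS.
move=> /forall_inP/(_ _ yr); rewrite lt_yd (leq_ltn_trans le_rx lt_xd) /= => /eqP eyr.
by rewrite -eyr ltnNge le_rx in lt_xy.
Qed.

Lemma leaders_decreasing n d (g : {set 'I_n * 'I_n}) :
  acyclic g -> decreasing (initial_segment n d) g ->
  leaders setT g = initial_segment n d :|: leaders (~: initial_segment n d) g.
Proof.
move=> ac /decreasingP dec; apply/setP => x; rewrite !inE /=.
have [lt_xd|//] := ltnP x d; apply/is_leaderP => y lt_yx; apply/negP => cyx.
have gxy : arc g x y by apply: dec; rewrite ?inE // (ltn_trans lt_yx).
by rewrite (acyclic_arc ac gxy) in cyx.
Qed.

Lemma card_initial_segment n d : (d <= n)%N -> #|initial_segment n d| = d.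
Proof.
move=> le_dn; have inj : injective (widen_ord le_dn).
  by move=> x y /(congr1 val)/= exy; apply: val_inj.
rewrite -[RHS]card_ord -(card_imset _ inj).
apply: eq_card => x; rewrite inE; apply/idP/imsetP => [lt_xd|[y _ ->] /=].
  by exists (Ordinal lt_xd) => //; apply: val_inj.
exact: ltn_ord.
Qed.

(** Every initial vertex except the first points to the first, and some sink exists; so only sinks
    beyond the clique could compete. *)
Lemma first_unique_sinkE n (G : sgraph n) d (g : {set 'I_n * 'I_n}) :
  (0 < d <= n)%N -> acyclic_orientation G setT g -> decreasing (initial_segment n d) g ->
  first_unique_sink g = (~: initial_segment n d :&: sinks g == set0).
Proof.
case/andP=> d_gt0 le_dn og /decreasingP dec.
pose x0 := Ordinal (leq_trans d_gt0 le_dn).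
apply/forallP/eqP => [us|e0 x].
  apply/setP => x; rewrite !inE (eqP (us x)) -leqNgt; apply/negP => /andP[le_dx /eqP x_0].
  by have : (d <= val x)%N := le_dx; rewrite x_0 leqNgt d_gt0.
have sink0 y : y \in sinks g -> val y = 0%N.
  move=> ys; have yd : (y < d)%N.
    by apply: contraFT (in_set0 y) => yd; rewrite -e0 !in_setI ys andbT !inE.
  apply/eqP; rewrite -leqn0 leqNgt; apply/negP => y_gt0.
  have := sinksP _ _ ys x0; rewrite dec ?inE //.
have [y _ ys] := acyclic_orientation_sink og (in_setT x0).
apply/eqP; apply/idP/eqP => [xs|x_0]; first by apply: sink0; rewrite inE.
have -> : x = y by apply: val_inj; rewrite /= x_0 (sink0 _ ys).
by move: ys; rewrite inE.
Qed.

Lemma mem_counted_orientations n (G : sgraph n) d i g :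
  (0 < d <= n)%N -> initial_clique G d ->
  (g \in counted_orientations G d i) =
  [&& dec_orientation G (initial_segment n d) (~: initial_segment n d) g,
      ~: initial_segment n d :&: sinks g == set0 & #|leaders (~: initial_segment n d) g| == i].
Proof.
move=> dn cl; rewrite inE /dec_orientation setUCr.
have -> : [&& orientation G g, acyclic g, #|source_components g| == (d + i)%N,
  in_distinct_components g d & first_unique_sink g] =
  [&& acyclic_orientation G setT g, #|source_components g| == (d + i)%N,
  in_distinct_components g d & first_unique_sink g].
  rewrite andbA; congr (_ && _); rewrite andbC; apply: andb_id2l => ac.
  apply: eq_forallb => x; apply: eq_forallb => y; rewrite !inE andbT.
  rewrite [~~ _](_ : _ = true) ?andbT //; apply/negP => /andP[gxy].
  by rewrite (acyclic_asym ac gxy).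
rewrite -andbA; apply: andb_id2l => og; have ac := acyclic_orientation_acyclic og.
rewrite (in_distinct_componentsE cl og) andbCA; apply: andb_id2l => dec.
rewrite (first_unique_sinkE dn og dec) andbC; congr (_ && _).
rewrite card_source_components (leaders_decreasing ac dec) cardsU.
have -> : initial_segment n d :&: leaders (~: initial_segment n d) g = set0.
  by apply/setP => x; rewrite !inE; case: (_ < _)%N.
by rewrite cards0 subn0 card_initial_segment ?eqn_add2l //; case/andP: dn.
Qed.

(** * The generating polynomial of the counted orientations and its values *)

Definition sinkless_poly n (G : sgraph n) (d : nat) : {poly int} :=
  \sum_(g | dec_orientation G (initial_segment n d) (~: initial_segment n d) g &&
            (~: initial_segment n d :&: sinks g == set0))
    'X^#|leaders (~: initial_segment n d) g|.

Lemma coef_sinkless_poly n (G : sgraph n) (d i : nat) :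
  (0 < d <= n)%N -> initial_clique G d ->
  (sinkless_poly G d)`_i = #|counted_orientations G d i|%:Z.
Proof.
move=> dn cl; rewrite coef_sum -sum1_card -[RHS]natz natr_sum.
rewrite [RHS](eq_bigl (fun g =>
  (dec_orientation G (initial_segment n d) (~: initial_segment n d) g &&
  (~: initial_segment n d :&: sinks g == set0)) &&
  (i == #|leaders (~: initial_segment n d) g|))); last first.
  by move=> g; rewrite mem_counted_orientations // -andbA [i == _]eq_sym.
rewrite [RHS]big_mkcondr /=; apply: eq_bigr => g _; rewrite coefXn.
by case: eqP.
Qed.

(** A sink outside the clique receives an arc from a smaller neighbor and so is no leader, which
    allows inclusion-exclusion over sinks. The resulting factor $e$ cancels one $a$: weight [k.+1]
    gives exponent [d + k]. *)
Lemma horner_sinkless_poly n (G : sgraph n) (d k : nat) :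
  (0 < d <= n)%N -> initial_clique G d ->
  (forall x : 'I_n, (0 < x)%N -> exists2 j : 'I_n, (j < x)%N & G x j) ->
  (sinkless_poly G d).[k.+1%:R] =
  (\prod_(c in initial_segment n d) signed_stable G [set c] *
     acyclic_count G ^+ (d + k)) (~: initial_segment n d).
Proof.
case/andP=> d_gt0 le_dn cl label.
transitivity ((signed_stable G set0 *
    leader_sum G (initial_segment n d) k.+1) (~: initial_segment n d)).
  rewrite -[X in leader_sum _ X _](setD0 (initial_segment n d)).
  rewrite sinkless_leader_sum ?sub0set //.
  - rewrite horner_sum; apply: eq_big => [g|g _]; first by rewrite sub0set andbT.
    by rewrite hornerXn.
  - by rewrite disjoints_subset setCK.
  - by move=> x y; rewrite inE.
  move=> g A /andP[og _] /subsetP As; congr (_ ^+ #|pred_of_set _|).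
  apply/setP => w; rewrite !in_set; have [wA|//] := boolP (w \in A).
  have := As _ wA; rewrite !in_set => /andP[wd ws].
  apply/esym/andP => -[_ /is_leaderP lw].
  have w_gt0 : (0 < w)%N by rewrite (leq_trans d_gt0) // leqNgt.
  have [j lt_jw Gwj] := label _ w_gt0.
  have := acyclic_orientationE w j og; rewrite Gwj setUCr !inE /=.
  have /forallP/(_ j)/negPf -> /= := ws.
  by move=> /connect1 cjw; have := lw _ lt_jw; rewrite cjw.
transitivity ((signed_stable G set0 * (\prod_(c in initial_segment n d) signed_stable G [set c]
    * acyclic_count G ^+ (d + k).+1)) (~: initial_segment n d)).
  apply: setfun_mul_local => // A AS.
  rewrite leader_sum_clique ?card_initial_segment ?addnS // => [x y|x y xd /(subsetP AS)].
    by rewrite !inE; apply: cl.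
  by rewrite !inE -leqNgt; apply: leq_trans; rewrite inE in xd.
by rewrite exprS mulrCA [signed_stable _ _ * _]mulrA signed_stable_acyclic_count mul1r.
Qed.

(** Two evaluations of $a^k$ at the full vertex set are compared: reciprocity and the extraction of
    the clique. The falling factorial at $-k$ is $(-1)^d$ times the rising factorial of the second
    one, which cancels. *)
Lemma sinkless_poly_chromatic_hat n (G : sgraph n) (d k : nat) :
  (0 < d <= n)%N -> initial_clique G d ->
  (forall x : 'I_n, (0 < x)%N -> exists2 j : 'I_n, (j < x)%N & G x j) ->
  (0 < k)%N ->
  (sinkless_poly G d).[k.+1%:R] = (-1) ^+ (n - d) * (chromatic_hat G d).[- k%:R].
Proof.
move=> dn cl label k_gt0; have [d_gt0 le_dn] := andP dn.
have clow : clique G (initial_segment n d) by move=> x y; rewrite !inE; apply: cl.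
have dlow : [disjoint initial_segment n d & ~: initial_segment n d].
  by rewrite disjoints_subset setCK.
have := acyclic_count_exp_clique k clow dlow.
rewrite card_initial_segment // addnC -horner_sinkless_poly // setUCr.
rewrite acyclic_count_exp_chromatic.
rewrite -(chromatic_hatK le_dn cl) hornerM.
have -> : (falling_poly d).[- k%:R] = (-1) ^+ d * \prod_(j < d) (k + j)%:R.
  rewrite horner_prod -[X in _ ^+ X]card_ord -prodrN; apply: eq_bigr => j _.
  by rewrite hornerXsubC natrD opprD.
(* Positivity of [k] matters here: the factor at [j = 0] is [k] itself. *)
have p_neq0 : \prod_(j < d) (k + j)%:R != 0 :> int.
  by apply/prodf_neq0 => j _; rewrite pnatr_eq0 -lt0n addn_gt0 k_gt0.
move=> E; apply: (mulfI p_neq0); rewrite -E.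
rewrite -[in (-1) ^+ n](subnK le_dn) exprD.
have : (-1) ^+ d * (-1) ^+ d = 1 :> int by rewrite -exprMn mulrNN mulr1 expr1n.
set h := (chromatic_hat G d).[_]; set p := \prod_(j < d) _.
move: ((-1) ^+ d) ((-1) ^+ (n - d)) => s t ss; transitivity (s * s * (p * (t * h))).
  by ring.
by rewrite ss mul1r.
Qed.

Lemma coef_comp_polyN (R : comNzRingType) (p : {poly R}) i :
  (p \Po - 'X)`_i = (-1) ^+ i * p`_i.
Proof.
elim/poly_ind: p i => [|p c IHp] i; first by rewrite comp_poly0 !coef0 mulr0.
rewrite comp_polyD comp_polyC comp_polyM comp_polyX mulrN !coefD coefN !coefMX !coefC.
case: i => [|i] /=; first by rewrite oppr0 expr0 mul1r.
by rewrite IHp !addr0 exprS mulN1r mulNr.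
Qed.

Theorem theorem4p7 (n : nat) (G : sgraph n) (d : nat)
    (Gconn : connected_graph G)
    (d_gt0 : (0 < d)%N) (d_le_n : (d <= n)%N)
    (Gclique : initial_clique G d)
    (Glabel : forall k : 'I_n, (0 < k)%N ->
       exists2 j : 'I_n, (j < k)%N & G k j)
    (i : nat) :
  (-1 : int) ^ (n%:Z - d%:Z - i%:Z) * (chromatic_hat G d \Po ('X + 1%:P))`_i
  = #|counted_orientations G d i|%:Z.
Proof.
have dn : (0 < d <= n)%N by rewrite d_gt0.
set Q := chromatic_hat G d \Po ('X + 1%:P).
(* As $Q(q) = \widehat\chi_d(q+1)$, the value at $k+1$ is $(-1)^{n-d} \widehat\chi_d(-k) =
   (-1)^{n-d} Q(-(k+1))$. *)
suff E : sinkless_poly G d = (-1) ^+ (n - d) *: (Q \Po - 'X).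
  rewrite -coef_sinkless_poly // E coefZ coef_comp_polyN mulrA; congr (_ * _).
  (* The integer exponent may be negative; $(-1)^{-i} = (-1)^i$ because $-1$ is its own inverse. *)
  rewrite subzn // exprzDr ?unitrN1 // -exprnP; congr (_ * _).
  by rewrite -exprz_inv -exprnP.
(* The values are known at the integers from 2 on; the shift by 2 makes them cover all naturals, as
   [poly_eq_nat] requires. *)
suff E : sinkless_poly G d \Po ('X + 2%:P) =
    ((-1) ^+ (n - d) *: (Q \Po - 'X)) \Po ('X + 2%:P).
  have XK : ('X + 2%:P) \Po ('X - 2%:P) = 'X :> {poly int}.
    by rewrite comp_polyD comp_polyX comp_polyC subrK.
  by have := congr1 (comp_poly ('X - 2%:P)) E; rewrite -!comp_polyA XK !comp_polyXr.
apply: poly_eq_nat => k.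
rewrite horner_comp hornerD hornerX hornerC -natrD addn2 sinkless_poly_chromatic_hat //.
rewrite horner_comp hornerZ !horner_comp !hornerD !hornerN !hornerX !hornerC.
by congr (_ * _.[_]); rewrite -addn1 natrD; ring.
Qed.
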